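(* Let $n\ge 2$ and $c\in\mathbb{R}$. Let $\Gamma\subsetneqq\mathbb{R}^n$ be a non-empty open symmetric cone with vertex at the origin satisfying $\Gamma+\Gamma_n\subset\Gamma$, and assume $\lambda^*:=(1,-1,\dots,-1)\notin\overline{\Gamma}$. Let $v\in C^2(\overline{B^+}\setminus\{0\})$ satisfy $$\begin{cases}\lambda(A[v])\in\overline{\Gamma} & \text{in } B^+,\\ \frac{\partial v}{\partial x_n}\le c\,e^{v} & \text{on } \partial'B^+\setminus\{0\}.\end{cases}$$ Then $\liminf_{x\to 0}v(x)\in(-\infty,+\infty]$.
   Context: $\mathbb{R}^n_+=\{x\in\mathbb{R}^n: x_n>0\}$; $B$ is the open unit ball of $\mathbb{R}^n$ centered at $0$; $B^+=B\cap\mathbb{R}^n_+$; $\partial'B^+$ is the interior (in $\partial\mathbb{R}^n_+$) of $\partial B^+\cap\partial\mathbb{R}^n_+$, i.e. $\{|x|<1,\ x_n=0\}$. $\Gamma_n=\{\lambda\in\mathbb{R}^n:\lambda_i>0 \text{ for all } i\}$. A set is symmetric if it is invariant under permutations of the $\lambda_i$. For a $C^2$ function $v$, $A[v]=e^{-2v}\left(-\nabla^2v+\nabla v\otimes\nabla v-\frac12|\nabla v|^2I\right)$, and $\lambda(M)$ denotes the eigenvalues of the symmetric matrix $M$ (modulo permutations). *)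

(* Defs.v *)
From HB Require Import structures.
From mathcomp Require Import all_boot all_order all_algebra all_fingroup.
From mathcomp Require Import all_classical all_reals all_analysis.

Set Implicit Arguments.
Unset Strict Implicit.
Unset Printing Implicit Defensive.

Import Order.TTheory GRing.Theory Num.Theory.
Import numFieldNormedType.Exports.

Local Open Scope classical_set_scope.
Local Open Scope ring_scope.

(* Points of R^n, for n >= 1, are row vectors of size n.+1; the last
   coordinate is the one of index [ord_max].  The library norm on row vectors
   is the sup norm, which induces the usual topology; the Euclidean norm is
   therefore defined separately. *)

Definition enorm (R : realType) (n : nat) (x : 'rV[R]_n.+1) : R :=
  Num.sqrt (\sum_i x 0 i ^+ 2).

Definition basis_vec (R : realType) (n : nat) (i : 'I_n.+1) : 'rV[R]_n.+1 :=
  delta_mx 0 i.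
Arguments basis_vec {R n} i.

Definition half_ball (R : realType) (n : nat) : set 'rV[R]_n.+1 :=
  [set x | enorm x < 1 /\ 0 < x 0 ord_max].
Arguments half_ball {R n}.

Definition flat_boundary (R : realType) (n : nat) : set 'rV[R]_n.+1 :=
  [set x | enorm x < 1 /\ x 0 ord_max = 0].
Arguments flat_boundary {R n}.

Definition punctured_half_ball (R : realType) (n : nat) : set 'rV[R]_n.+1 :=
  closure half_ball `\` [set 0].
Arguments punctured_half_ball {R n}.

Definition extends_continuously (R : realType) (n : nat)
    (U E : set 'rV[R]_n.+1) (f : 'rV[R]_n.+1 -> R) : Prop :=
  exists2 g : 'rV[R]_n.+1 -> R,
    {within E, continuous g} & forall x, U x -> f x = g x.

(* [v] is C^2 on [E], where [U] is open and [U `<=` E `<=` closure U]: [v] is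
   continuous on [E], and its partial derivatives of order 1 and 2 exist in [U]
   and have continuous extensions to [E].  Only the values of [v] on [E]
   matter. *)
Definition C2_up_to_boundary (R : realType) (n : nat)
    (U E : set 'rV[R]_n.+1) (v : 'rV[R]_n.+1 -> R) : Prop :=
  [/\ {within E, continuous v},
      forall i x, U x -> derivable v x (basis_vec i),
      forall i, extends_continuously U E ('D_(basis_vec i) v),
      forall i j x, U x ->
        derivable ('D_(basis_vec i) v) x (basis_vec j) &
      forall i j,
        extends_continuously U E ('D_(basis_vec j) ('D_(basis_vec i) v))].

Definition gradient (R : realType) (n : nat) (v : 'rV[R]_n.+1 -> R)
    (x : 'rV[R]_n.+1) : 'rV[R]_n.+1 :=
  \row_i 'D_(basis_vec i) v x.

Definition hessian (R : realType) (n : nat) (v : 'rV[R]_n.+1 -> R)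
    (x : 'rV[R]_n.+1) : 'M[R]_n.+1 :=
  \matrix_(i, j) 'D_(basis_vec j) ('D_(basis_vec i) v) x.

Definition conformal_hessian (R : realType) (n : nat) (v : 'rV[R]_n.+1 -> R)
    (x : 'rV[R]_n.+1) : 'M[R]_n.+1 :=
  expR (- 2 * v x) *:
    (- hessian v x + (gradient v x)^T *m gradient v x
     - (2^-1 * enorm (gradient v x) ^+ 2)%:M).

(* The derivative in the direction of the last coordinate at a point of the
   flat boundary; it is one-sided since [v] is only meaningful on the closed
   half ball. *)
Definition normal_derivative (R : realType) (n : nat) (v : 'rV[R]_n.+1 -> R)
    (x : 'rV[R]_n.+1) : R :=
  lim (h^-1 * (v (x + h *: basis_vec ord_max) - v x) @[h --> 0^'+]).

(* [lam] lists the eigenvalues of [M] with multiplicities, in some order. *)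
Definition is_eigenvalue_vector (R : realType) (n : nat) (M : 'M[R]_n.+1)
    (lam : 'rV[R]_n.+1) : Prop :=
  char_poly M = \prod_i ('X - (lam 0 i)%:P).

Definition eigenvalues_in (R : realType) (n : nat) (M : 'M[R]_n.+1)
    (S : set 'rV[R]_n.+1) : Prop :=
  exists2 lam, is_eigenvalue_vector M lam & S lam.

Definition positive_orthant (R : realType) (n : nat) : set 'rV[R]_n.+1 :=
  [set lam | forall i, 0 < lam 0 i].
Arguments positive_orthant {R n}.

Definition symmetric_set (R : realType) (n : nat) (S : set 'rV[R]_n.+1) : Prop :=
  forall (s : 'S_n.+1) lam, S lam -> S (col_perm s lam).

Definition cone_at_origin (R : realType) (n : nat) (S : set 'rV[R]_n.+1) : Prop :=
  forall (t : R) lam, 0 < t -> S lam -> S (t *: lam).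

(* (1, -1, ..., -1) *)
Definition lambda_star (R : realType) (n : nat) : 'rV[R]_n.+1 :=
  \row_i (if i == ord0 then 1 else - 1).
Arguments lambda_star {R n}.

(* Main.v *)
Require Import Defs.
From HB Require Import structures.
From mathcomp Require Import all_boot all_order all_algebra all_fingroup.
From mathcomp Require Import complex ring lra.
From mathcomp Require Import all_classical all_reals all_analysis.

(* Write N = n + 1, r = |x| and, for k small (a fixed multiple of the eta below)
   and delta > 0, compare v with the barrier (1/k) ln w - const, where
     w = 1 + delta ln r + r + k x_N.
   Since w < 0 near 0, the weight w e^{-k v} attains its maximum over the
   punctured half ball of radius 1/2 if it is positive somewhere.  This maximum
   is bounded independently of delta, and letting delta -> 0 then bounds v from
   below by a constant.
   - Interior maximum: grad v = grad w / (k w) and the Hessian of v is at least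
     that of (1/k) ln w.  Up to the tilt k x_N, the gradient of w is radial, and
     the Hessians of -ln r and -r are bounded by multiples of -I + 2 e e^T,
     e = x / r.  Hence A[v] <= t (-I + (2 + eta) e e^T) for some t > 0, so the
     eigenvalues of A[v] are at most t (1 + eta, -1, ..., -1).  For small eta
     this vector is outside the closure of Gamma, which is stable under
     increasing coordinates: a contradiction.
   - Maximum on the flat boundary: there the normal derivative of w is k, which
     forces d_N v >= 1/3, against d_N v <= c e^v if the maximum, hence -v, is
     large.
   - Maximum on the outer sphere: v is bounded there. *)

Set Implicit Arguments.
Unset Strict Implicit.
Unset Printing Implicit Defensive.

Import Order.TTheory GRing.Theory Num.Theory.
Import numFieldNormedType.Exports.

Local Open Scope classical_set_scope.
Local Open Scope ring_scope.

(** * Symmetric matrices bounded by a scalar plus a rank-one matrix *)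

Definition dot (R : pzRingType) n (u w : 'rV[R]_n) : R := \sum_i u 0 i * w 0 i.

Definition qform (R : pzRingType) n (M : 'M[R]_n) (u : 'rV[R]_n) : R :=
  \sum_j (\sum_i u 0 i * M i j) * u 0 j.

Section dot.
Variables (R : realDomainType) (n : nat).
Implicit Types u w z : 'rV[R]_n.

Lemma dotC u w : dot u w = dot w u.
Proof. by apply: eq_bigr => i _; rewrite mulrC. Qed.

Lemma dotDl u w z : dot (u + w) z = dot u z + dot w z.
Proof. by rewrite -big_split; apply: eq_bigr => i _; rewrite mxE mulrDl. Qed.

Lemma dotDr u w z : dot z (u + w) = dot z u + dot z w.
Proof. by rewrite dotC dotDl !(dotC z). Qed.

Lemma dotZl a u w : dot (a *: u) w = a * dot u w.
Proof. by rewrite mulr_sumr; apply: eq_bigr => i _; rewrite mxE mulrA. Qed.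

Lemma dotZr a u w : dot u (a *: w) = a * dot u w.
Proof. by rewrite dotC dotZl dotC. Qed.

Lemma dot_ge0 u : 0 <= dot u u.
Proof. by apply: sumr_ge0 => i _; rewrite -expr2 sqr_ge0. Qed.

(** Cauchy-Schwarz for a unit vector: expand the square norm of u - (u . e) e. *)
Lemma dot_unit_sqr_le u e : dot e e = 1 -> dot u e ^+ 2 <= dot u u.
Proof.
move=> e1; have := dot_ge0 (u + (- dot u e) *: e).
rewrite !(dotDl, dotDr, dotZl, dotZr) e1 (dotC e u) => le0.
lra.
Qed.

End dot.

Lemma char_poly_conjmx (R : comUnitRingType) n (U D : 'M[R]_n) :
  U \in unitmx -> char_poly (invmx U *m D *m U) = char_poly D.
Proof.
move=> Uu; rewrite /char_poly.
have -> : char_poly_mx (invmx U *m D *m U) =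
    map_mx polyC (invmx U) *m char_poly_mx D *m map_mx polyC U.
  rewrite /char_poly_mx mulmxBr mulmxBl scalar_mxC -!mulmxA -!map_mxM.
  by rewrite mulVmx// map_mx1 mulmx1.
by rewrite !det_mulmx mulrAC -det_mulmx -map_mxM mulVmx// map_mx1 det1 mul1r.
Qed.

(** * Eigenvalues through the complex spectral theorem *)

Section spectrum.
Variables (R : rcfType) (n : nat).
Local Open Scope sesquilinear_scope.
Local Notation C := R[i].
Local Notation toC := (real_complex R).
Local Notation re := (map_mx (@complex.Re R)).
Local Notation im := (map_mx (@complex.Im R)).

Lemma Re_sum I (r : seq I) (F : I -> C) :
  complex.Re (\sum_(i <- r) F i) = \sum_(i <- r) complex.Re (F i).
Proof. by apply: (big_morph (@complex.Re R)) => // -[? ?] [? ?]. Qed.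

Lemma Im_sum I (r : seq I) (F : I -> C) :
  complex.Im (\sum_(i <- r) F i) = \sum_(i <- r) complex.Im (F i).
Proof. by apply: (big_morph (@complex.Im R)) => // -[? ?] [? ?]. Qed.

Lemma complex_eq (z : C) a b :
  complex.Re z = a -> complex.Im z = b -> z = Complex a b.
Proof. by case: z => ? ? /= -> ->. Qed.

(** Diagonalization takes place over the complex numbers, whereas the bound on [M] concerns real
    vectors. For a real matrix the cross terms between real and imaginary parts only enter the
    imaginary part of the form. *)
Lemma Re_hform (M : 'M[R]_n) (x : 'rV[C]_n) :
  complex.Re ((x *m map_mx toC M *m x^t*) 0 0) =
  qform M (re x) + qform M (im x).
Proof.
rewrite mxE Re_sum -big_split; apply: eq_bigr => j _ /=.
rewrite !mxE.
have -> : \sum_i x 0 i * map_mx toC M i j =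
   Complex (\sum_i re x 0 i * M i j) (\sum_i im x 0 i * M i j).
  apply: complex_eq.
  - rewrite Re_sum; apply: eq_bigr => i _; rewrite !mxE.
    by case: (x 0 i) => a b /=; rewrite mulr0 subr0.
  - rewrite Im_sum; apply: eq_bigr => i _; rewrite !mxE.
    by case: (x 0 i) => a b /=; rewrite mulr0 add0r.
by case: (x 0 j) => a b /=; rewrite mulrN opprK.
Qed.

Variables (M : 'M[R]_n) (lam e : 'rV[R]_n) (t s : R).
Hypotheses (M_sym : M^T = M)
  (M_char : char_poly M = \prod_i ('X - (lam 0 i)%:P))
  (e1 : dot e e = 1) (s_ge0 : 0 <= s)
  (M_le : forall u, qform M u <= - t * dot u u + s * dot u e ^+ 2).

Local Notation MC := (map_mx toC M).
Local Notation P := (spectralmx MC).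
Local Notation d := (spectral_diag MC).

Lemma complexification_hermitian : MC \is hermsymmx.
Proof.
apply/is_hermitianmxP; rewrite expr0 scale1r; apply/matrixP => i j.
rewrite !mxE -[in LHS]M_sym mxE; apply/eqP; rewrite eq_complex /= oppr0.
by rewrite !eqxx.
Qed.

Lemma char_poly_spectral_diag : char_poly MC = \prod_i ('X - (d 0 i)%:P).
Proof.
have {1}-> : MC = invmx P *m diag_mx d *m P.
  exact/orthomx_spectralP/hermitian_normalmx/complexification_hermitian.
rewrite char_poly_conjmx ?spectral_unit// char_poly_trig ?diag_mx_is_trig//.
by apply: eq_bigr => i _; rewrite mxE eqxx mulr1n.
Qed.

(** The characteristic polynomial splits over [lam] and over the spectral diagonal; the roots of a
    split polynomial are unique up to order. *)
Lemma spectral_diag_perm : exists p : 'S_n, forall i, d 0 i = toC (lam 0 (p i)).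
Proof.
have : \prod_(x <- [tuple d 0 i | i < n]) ('X - x%:P) =
       \prod_(x <- [tuple toC (lam 0 i) | i < n]) ('X - x%:P).
  have := map_char_poly toC M; rewrite M_char rmorph_prod char_poly_spectral_diag.
  rewrite !big_tuple => mE; under eq_bigr do rewrite tnth_mktuple.
  rewrite -mE; apply: eq_bigr => i _.
  by rewrite tnth_mktuple rmorphB/= map_polyX map_polyC.
move/prod_XsubC_eq/tuple_permP => [p pE]; exists p => i.
have := congr1 (fun s => nth 0 s i) pE.
by rewrite -!tnth_nth !tnth_mktuple.
Qed.

Lemma mulmx_complexification (x : 'rV[C]_n) :
  (x *m (map_mx toC e)^T) 0 0 = Complex (dot (re x) e) (dot (im x) e).
Proof.
rewrite mxE; apply: complex_eq.
- rewrite Re_sum; apply: eq_bigr => i _; rewrite !mxE.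
  by case: (x 0 i) => a b /=; rewrite mulr0 subr0.
- rewrite Im_sum; apply: eq_bigr => i _; rewrite !mxE.
  by case: (x 0 i) => a b /=; rewrite mulr0 add0r.
Qed.

Lemma qform_diag (f u : 'rV[R]_n) :
  qform (diag_mx f) u = \sum_i f 0 i * u 0 i ^+ 2.
Proof.
apply: eq_bigr => j _; rewrite (bigD1 j)//= big1 ?addr0 => [|i ij].
  by rewrite mxE eqxx mulr1n mulrAC mulrC expr2.
by rewrite mxE (negbTE ij) mulr0n mulr0.
Qed.

Lemma qform1 (u : 'rV[R]_n) : qform 1%:M u = dot u u.
Proof.
by rewrite -diag_const_mx qform_diag; apply: eq_bigr => i _; rewrite mxE mul1r.
Qed.

(** Norm preservation by the unitary matrix [P], read off from [Re_hform] at the identity matrix. *)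
Lemma unitary_dot (al : 'rV[C]_n) : let x := al *m P in
  dot (re x) (re x) + dot (im x) (im x) =
  dot (re al) (re al) + dot (im al) (im al).
Proof.
move=> x; have := Re_hform 1%:M x; rewrite !qform1 => <-.
have := Re_hform 1%:M al; rewrite !qform1 => <-.
rewrite map_mx1 !mulmx1 /x trmx_mul map_mxM mulmxA mulmxtVK//.
exact: spectral_unitarymx.
Qed.

Lemma unitary_qform (p : 'S_n) (al : 'rV[C]_n) :
  (forall i, d 0 i = toC (lam 0 (p i))) -> let x := al *m P in
  qform M (re x) + qform M (im x) =
  \sum_i lam 0 (p i) * (re al 0 i ^+ 2 + im al 0 i ^+ 2).
Proof.
move=> dE x; rewrite -Re_hform.
have MCE : MC = P^t* *m diag_mx d *m P.
  rewrite -invmx_unitary ?spectral_unitarymx//.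
  exact/orthomx_spectralP/hermitian_normalmx/complexification_hermitian.
have -> : x *m MC *m x^t* =
    al *m map_mx toC (diag_mx (\row_i lam 0 (p i))) *m al^t*.
  rewrite {1}MCE /x trmx_mul map_mxM !mulmxA.
  rewrite !(mulmxtVK _ (spectral_unitarymx _)).
  congr (_ *m _ *m _); apply/matrixP => i j; rewrite !mxE dE.
  by rewrite rmorphMn.
rewrite Re_hform !qform_diag -big_split; apply: eq_bigr => i _ /=.
by rewrite !mxE mulrDr.
Qed.

Local Notation sqn z := (complex.Re z ^+ 2 + complex.Im z ^+ 2).

(* [al] lists the coordinates of a vector in a unitary basis of eigenvectors, and
   [c] the inner products of the basis vectors with [e]. *)
Lemma spectral_coordinates_le :
  exists (p : 'S_n) (c : 'I_n -> C), forall al : 'I_n -> C,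
  let z := \sum_i al i * c i in
  sqn z <= \sum_i sqn (al i) /\
  \sum_i lam 0 (p i) * sqn (al i) <= - t * \sum_i sqn (al i) + s * sqn z.
Proof.
have [p pE] := spectral_diag_perm.
exists p, (fun i => (P *m (map_mx toC e)^T) i 0) => al z.
pose a := \row_i al i; pose x := a *m P.
have zE : z = Complex (dot (re x) e) (dot (im x) e).
  rewrite -mulmx_complexification /x -mulmxA mxE; apply: eq_bigr => i _.
  by rewrite [a 0 i]mxE.
have sqE : \sum_i sqn (al i) = dot (re x) (re x) + dot (im x) (im x).
  rewrite unitary_dot -big_split; apply: eq_bigr => i _.
  by rewrite !mxE -!expr2.
rewrite zE sqE /=; split.
  exact: lerD (dot_unit_sqr_le _ e1) (dot_unit_sqr_le _ e1).
have /= := unitary_qform a pE; under eq_bigr do rewrite !mxE.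
by move=> <-; rewrite !mulrDr addrACA; exact: lerD.
Qed.

(* Two eigenvectors have a nonzero combination orthogonal to [e], on which [M] is
   at most [- t]; so two eigenvalues cannot both exceed [- t]. *)
Lemma eigenvalues_le : (forall i, lam 0 i <= s - t) /\
  (forall i j, i != j -> lam 0 i <= - t \/ lam 0 j <= - t).
Proof.
have [p [c pcP]] := spectral_coordinates_le.
have sum1 (V : zmodType) (F : 'I_n -> V) k :
    (forall l, l != k -> F l = 0) -> \sum_l F l = F k.
  by move=> F0; rewrite (bigD1 k)//= big1 ?addr0.
have sum2 (V : zmodType) (F : 'I_n -> V) k l : k != l ->
    (forall m, m != k -> m != l -> F m = 0) -> \sum_m F m = F k + F l.
  move=> kl F0; rewrite (bigD1 k)//= (bigD1 l) 1?eq_sym//= big1 ?addr0//.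
  by move=> m /andP[]; exact: F0.
(* The coordinates of a single eigenvector give the bound on each eigenvalue. *)
have eig i : lam 0 (p i) <= - t + s * sqn (c i) /\ sqn (c i) <= 1.
  have [] := pcP (fun l => (l == i)%:R).
  have z l : l != i -> (l == i)%:R = 0 :> C by move=> /negbTE ->.
  rewrite !(sum1 _ _ i) ?eqxx/= => [|l /z->|l /z->|l /z->];
    rewrite ?mul0r/= ?expr0n/= ?addr0 ?mulr0//.
  by rewrite mul1r !expr1n !mulr1.
split=> [i|i j ij].
  rewrite -(permKV p i); have [le1 le2] := eig (p^-1 i)%g.
  apply: le_trans le1 _; rewrite [leRHS]addrC lerD2l.
  exact: ler_piMr.
rewrite -(permKV p i) -(permKV p j).
have : (p^-1)%g i != (p^-1)%g j by rewrite (inj_eq perm_inj).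
move: (_ i) (_ j) => {ij} {}i {}j ij.
(* If [c i] vanishes, the eigenvector of index [i] is itself orthogonal to [e]. *)
have [ci0|ci0] := eqVneq (c i) 0.
  by left; have [+ _] := eig i; rewrite ci0/= expr0n addr0 mulr0 addr0.
apply/orP; rewrite leNgt [X in _ || X]leNgt -negb_and; apply/negP => /andP[li lj].
pose al l := if l == i then - c j else if l == j then c i else 0.
have ai : al i = - c j by rewrite /al eqxx.
have aj : al j = c i by rewrite /al eqxx eq_sym (negbTE ij).
have a0 l : l != i -> l != j -> al l = 0.
  by rewrite /al => /negbTE-> /negbTE->.
have z0 : al i * c i + al j * c j = 0.
  by rewrite ai aj mulNr [c i * c j]mulrC addNr.
have [] := pcP al => _.
rewrite !(sum2 _ _ i j ij) => [|l ? ?|l ? ?|l ? ?]; last 3 first.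
- by rewrite a0// mul0r.
- by rewrite a0//= expr0n addr0.
- by rewrite a0//= expr0n addr0 mulr0.
rewrite z0 ai aj /= expr0n/= addr0 mulr0 addr0 [- t * _]mulrDr.
have sqn_ge0 (z : C) : 0 <= sqn z by rewrite addr_ge0 ?sqr_ge0.
have cj0 : 0 <= sqn (- c j) by [].
(* This makes one of the two inequalities strict, so the weighted sum of the two eigenvalues exceeds
   [- t] times the total weight, against the bound at z = 0. *)
have {}ci0 : 0 < sqn (c i).
  rewrite lt_def sqn_ge0 andbT; apply: contraNneq ci0.
  case: (c i) => a b /= /eqP; rewrite paddr_eq0 ?sqr_ge0// !sqrf_eq0.
  by move=> /andP[/eqP-> /eqP->].
apply/negP; rewrite -ltNge ler_ltD//.
  by apply: ler_wpM2r => //; exact: ltW.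
by rewrite ltr_pM2r.
Qed.

(** At most one eigenvalue exceeds [- t]; a transposition brings it to position [i0]. *)
Lemma eigenvalues_le_perm (i0 : 'I_n) : exists q : 'S_n,
  forall i, lam 0 (q i) <= (if i == i0 then s - t else - t).
Proof.
have [lam1 lam2] := eigenvalues_le.
have [k lk] : exists k, forall i, i != k -> lam 0 i <= - t.
  have [k lk|nk] := pickP (fun k => - t < lam 0 k); last first.
    by exists i0 => i _; rewrite leNgt nk.
  by exists k => i /lam2[//|]; rewrite leNgt lk.
exists (tperm i0 k) => i; case: eqVneq => [_|ii0]; [exact: lam1|apply: lk].
by apply: contraNneq ii0 => /(congr1 (tperm i0 k)); rewrite tpermK tpermR => ->.
Qed.

End spectrum.

(** * Cones of eigenvalues *)

Section cones.
Variables (R : realType) (n : nat).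
Implicit Types (A : set 'rV[R]_n.+1) (x y lam : 'rV[R]_n.+1).

Lemma closure_rVP A x : closure A x <->
  forall e, 0 < e -> exists2 y, A y & forall i, `|x 0 i - y 0 i| < e.
Proof.
split=> [Ax e e0|Ax B].
  have [|y [Ay [_ xy]]] := Ax (ball x e); first exact: nbhsx_ballx.
  by exists y => // i; exact: xy.
move=> /nbhs_ballP[e /= e0 xeB]; have [y Ay xy] := Ax e e0.
by exists y; split => //; apply: xeB; split => // i j; rewrite ord1; exact: xy.
Qed.

Variable Gamma : set 'rV[R]_n.+1.
Hypotheses (Gamma_sym : symmetric_set Gamma)
  (Gamma_cone : cone_at_origin Gamma)
  (Gamma_add : [set lam + mu | lam in Gamma & mu in positive_orthant]
                   `<=` Gamma).

Lemma closure_symmetric_set : symmetric_set (closure Gamma).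
Proof.
move=> s lam /closure_rVP Gl; apply/closure_rVP => e /Gl[y Gy ly].
by exists (col_perm s y); [exact: Gamma_sym|move=> i; rewrite !mxE].
Qed.

Lemma closure_cone_at_origin : cone_at_origin (closure Gamma).
Proof.
move=> t lam t0 /closure_rVP Gl; apply/closure_rVP => e e0.
have [|y Gy ly] := Gl (e / t); first exact: divr_gt0.
exists (t *: y); [exact: Gamma_cone|move=> i; rewrite !mxE -mulrBr normrM].
by rewrite gtr0_norm// mulrC -ltr_pdivlMr.
Qed.

Lemma closure_ge lam x : closure Gamma lam -> (forall i, lam 0 i <= x 0 i) ->
  closure Gamma x.
Proof.
move=> /closure_rVP Gl lx; apply/closure_rVP => e e0.
have e20 : 0 < e / 2 by rewrite divr_gt0.
have [y Gy ly] := Gl _ e20.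
(* The shift by e / 2 makes the nonnegative increment [x - lam] strictly positive, as [Gamma_add]
   requires. *)
exists (y + (x - lam + const_mx (e / 2))).
  apply: Gamma_add; exists y => //; exists (x - lam + const_mx (e / 2)) => // i.
  by rewrite !mxE ltr_wpDl// subr_ge0.
move=> i; have := ly i; rewrite !mxE !ltr_norml => /andP[? ?].
by apply/andP; split; lra.
Qed.

(** The complement of the closure is open, hence contains (1 + eta, -1, ..., -1) for small eta. The
    closure is symmetric, conic and stable under increasing coordinates, so a [lam] in it that is
    dominated by a multiple of this vector would put the vector itself in the closure. *)
Lemma closure_avoids_near_lambda_star : ~ closure Gamma lambda_star ->
  exists2 eta : R, 0 < eta <= 1 & forall lam t (q : 'S_n.+1), 0 < t ->
   (forall i, lam 0 (q i) <= (if i == ord0 then t * (1 + eta) else - t)) ->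
   ~ closure Gamma lam.
Proof.
move=> /closure_rVP/existsNP[e /not_implyP[e0 eP]].
(* Half of the radius is spent on eta and half on approximation by points of [Gamma]; the cap 1
   serves the numerical estimates on [k]. *)
exists (Num.min (e / 2) 1); first by rewrite lt_min ge_min lexx orbT divr_gt0 ?ltr01.
move=> lam t q t0 le_lam Glam; set eta := Num.min _ _ in le_lam.
have Gx : closure Gamma
    (\row_i (if i == ord0 then t * (1 + eta) else - t) : 'rV[R]_n.+1).
  apply: (@closure_ge (col_perm q lam)); first exact: closure_symmetric_set.
  by move=> i; rewrite !mxE.
have /closure_rVP : closure Gamma
    (\row_i (if i == ord0 then 1 + eta else - 1) : 'rV[R]_n.+1).
  have t'0 : 0 < t^-1 by rewrite invr_gt0.
  have := closure_cone_at_origin t'0 Gx; congr closure; apply/rowP => i; rewrite !mxE.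
  by case: ifP => _; rewrite ?mulrN ?mulVf ?mulKf ?gt_eqF//.
move=> /(_ (e / 2)); rewrite divr_gt0// => /(_ isT)[y Gy yP].
apply: eP; exists y => // i; have := yP i; rewrite !mxE.
have eta0 : 0 < eta <= e / 2 by rewrite lt_min ge_min lexx/= divr_gt0 ?ltr01.
move: eta0; clearbody eta => /andP[eta0 eta1].
case: ifP => _; rewrite !ltr_norml => /andP[? ?]; apply/andP; split; lra.
Qed.
End cones.

(** * Directional derivatives *)

Section directional.
Variables (R : realType) (V : normedModType R).
Implicit Types (f : V -> R) (x y u w : V).

Lemma is_derive_line f x u (t d : R) : is_derive (x + t *: u) u f d ->
  is_derive t (1 : R) (fun s => f (x + s *: u)) d.
Proof.
have E : (fun h : R => h^-1 *:
    (((fun s : R => f (x + s *: u)) \o shift t) (h *: (1 : R)) - f (x + t *: u)))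
  = (fun h => h^-1 *: ((f \o shift (x + t *: u)) (h *: u) - f (x + t *: u))).
  apply/funext => h /=; congr (_ *: (f _ - _)).
  by rewrite [h *: 1]mulr1 scalerDl addrCA.
by case=> df dfE; split; [rewrite /derivable E|rewrite -dfE /derive E].
Qed.

Lemma is_derive_translate f x y u (d : R) : is_derive (x + y) u f d ->
  is_derive x u (fun z => f (z + y)) d.
Proof.
have E : (fun h : R => h^-1 *:
    (((fun z => f (z + y)) \o shift x) (h *: u) - f (x + y)))
  = (fun h => h^-1 *: ((f \o shift (x + y)) (h *: u) - f (x + y))).
  by apply/funext => h /=; rewrite addrA.
by case=> df dfE; split; [rewrite /derivable E|rewrite -dfE /derive E].
Qed.

Lemma derivable1_continuous_within (g dg : R -> R) (A : set R) :
  (forall t, A t -> is_derive t 1 g (dg t)) -> {within A, continuous g}.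
Proof.
move=> dgP; apply: continuous_in_subspaceT => t; rewrite inE => At.
by apply/differentiable_continuous/derivable1_diffP; case: (dgP t At).
Qed.

Lemma MVT_dir f x u (a : R) :
  (forall t, `|t| <= `|a| -> derivable f (x + t *: u) u) ->
  exists2 t, `|t| <= `|a| & f (x + a *: u) - f x = a * 'D_u f (x + t *: u).
Proof.
move=> df; pose g (t : R) := f (x + t *: u).
have dg (t : R) : `|t| <= `|a| -> is_derive t 1 g ('D_u f (x + t *: u)).
  by move=> ta; apply: is_derive_line; apply/derivableP/df.
have g0 : g 0 = f x by rewrite /g scale0r addr0.
have [a0|a0|a0] := ltgtP a 0.
- have ineq t : t \in `[a, 0]%R -> `|t| <= `|a|.
    by rewrite in_itv/= => /andP[? ?]; rewrite !ler0_norm ?lerN2 ?(ltW a0).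
  have [t ta gE] := @MVT _ g (fun t => 'D_u f (x + t *: u)) _ _ a0
    (fun t ta => dg t (ineq _ (subset_itv_oo_cc ta)))
    (derivable1_continuous_within (fun t ta => dg t (ineq _ ta))).
  exists t; first by apply/ineq/subset_itv_oo_cc.
  by rewrite -g0 -/(g a) -opprB gE sub0r mulrN opprK mulrC.
- have ineq t : t \in `[0, a]%R -> `|t| <= `|a|.
    by rewrite in_itv/= => /andP[? ?]; rewrite !ger0_norm ?(ltW a0).
  have [t ta gE] := @MVT _ g (fun t => 'D_u f (x + t *: u)) _ _ a0
    (fun t ta => dg t (ineq _ (subset_itv_oo_cc ta)))
    (derivable1_continuous_within (fun t ta => dg t (ineq _ ta))).
  exists t; first by apply/ineq/subset_itv_oo_cc.
  by rewrite -g0 -/(g a) gE subr0 mulrC.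
- by exists 0; rewrite ?normr0// a0 scale0r addr0 subrr mul0r.
Qed.

(** The difference quotient splits into the quotient along [w] at [x] and an increment along [u]
    based at the moving point x + h w. The mean value theorem and the continuity of the derivative
    along [u] handle the second one. *)
Lemma is_derive_add f x u w (c : R) :
  (\forall y \near x, derivable f y u) -> {for x, continuous ('D_u f)} ->
  derivable f x w -> is_derive x (w + c *: u) f ('D_w f x + c * 'D_u f x).
Proof.
move=> df cf dw.
suff cv : h^-1 *: ((f \o shift x) (h *: (w + c *: u)) - f x) @[h --> 0^']
    --> 'D_w f x + c * 'D_u f x.
  by split; [apply/cvg_ex; exists ('D_w f x + c * 'D_u f x)|exact: cvg_lim cv].
have -> : (fun h : R => h^-1 *: ((f \o shift x) (h *: (w + c *: u)) - f x)) =
   (fun h => h^-1 *: ((f \o shift x) (h *: w) - f x)) +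
   (fun h => h^-1 *: (f (x + h *: w + (h * c) *: u) - f (x + h *: w))).
  apply/funext => h; rewrite -[RHS]/(_ *: _ + _ *: _) -scalerDr; congr (_ *: _) => /=.
  have -> : h *: (w + c *: u) + x = x + h *: w + (h * c) *: u.
    by rewrite scalerDr scalerA addrC addrA.
  by rewrite [h *: w + x]addrC; ring.
apply: cvgD; first exact: dw.
apply/cvgrPdist_le => e e0.
have e'0 : 0 < e / (`|c| + 1) by rewrite divr_gt0// ltr_wpDl.
have : \forall y \near x, derivable f y u /\
    `|'D_u f x - 'D_u f y| <= e / (`|c| + 1).
  by apply: filterI => //; move/cvgrPdist_le : cf; exact.
move=> /nbhs_ballP[r /= r0 rP].
(* For |h| < r / k, the whole segment of the increment along [u] stays in the ball of radius [r]. *)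
pose k := `|w| + `|c| * `|u| + 1.
have k0 : 0 < k by rewrite ltr_wpDl// addr_ge0// mulr_ge0.
near=> h.
have h0 : h != 0 by near: h; exact: nbhs_dnbhs_neq.
have hr : `|h| < r / k.
  by near: h; apply: dnbhs0_lt; exact: divr_gt0.
have inball t : `|t| <= `|h * c| -> ball x r (x + h *: w + t *: u).
  move=> tc; rewrite -ball_normE/= -addrA opprD addNKr normrN.
  apply: le_lt_trans (_ : `|h| * k < _); last by rewrite -ltr_pdivlMr.
  apply: le_trans (ler_normD _ _) _; rewrite !normrZ /k mulrDr mulr1 mulrDr.
  rewrite -addrA lerD2l mulrA -normrM; apply: ler_wpDr => //.
  exact: ler_wpM2r.
have [t tc ->] := MVT_dir (fun t tc => (rP _ (inball t tc)).1).
rewrite -mulrA scalerA mulVf// scale1r -mulrBr normrM.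
apply: le_trans (ler_wpM2l _ (rP _ (inball t tc)).2) _ => //.
rewrite mulrCA ler_piMr ?(ltW e0)// ler_pdivrMr ?ltr_wpDl// mul1r.
by rewrite lerDl.
Unshelve. all: by end_near. Qed.

(** Two mean value theorems: along [u] for the difference y |-> f (y + s w) - f y, then along [w]
    for the derivative along [u]. *)
Lemma mixed_difference f x u w (r s : R) : 0 <= s ->
  s * (`|u| + `|w|) < r ->
  (forall y, ball x r y -> derivable f y u /\ derivable ('D_u f) y w) ->
  exists2 y, `|x - y| <= s * (`|u| + `|w|) &
    f (x + s *: u + s *: w) - f (x + s *: u) - (f (x + s *: w) - f x) =
    s * (s * 'D_w ('D_u f) y).
Proof.
move=> s0 sr df.
have dist (a b : R) : `|a| <= `|s| -> `|b| <= `|s| ->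
    `|x - (x + a *: u + b *: w)| <= s * (`|u| + `|w|).
  rewrite (ger0_norm s0) => al bl; rewrite -addrA opprD addNKr normrN.
  apply: le_trans (ler_normD _ _) _; rewrite !normrZ mulrDr.
  by apply: lerD; apply: ler_wpM2r.
have inball (a b : R) : `|a| <= `|s| -> `|b| <= `|s| ->
    ball x r (x + a *: u + b *: w).
  by move=> al bl; rewrite -ball_normE; exact: le_lt_trans (dist _ _ al bl) sr.
pose g y := f (y + s *: w) - f y.
have dg a : `|a| <= `|s| -> is_derive (x + a *: u) u g
    ('D_u f (x + a *: u + s *: w) - 'D_u f (x + a *: u)).
  move=> al; apply: is_deriveB.
    apply: is_derive_translate; apply/derivableP.
    exact: (df _ (inball a s al (lexx _))).1.
  have := inball a 0 al; rewrite normr0 scale0r addr0 => /(_ (normr_ge0 _)).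
  by move=> /df[/derivableP].
have [a al gE] := MVT_dir (fun a al => @ex_derive _ _ _ _ _ _ _ (dg a al)).
have [b bl dE] := MVT_dir (fun b bl => (df _ (inball a b al bl)).2).
exists (x + a *: u + b *: w); first exact: dist.
by rewrite -dE -(@derive_val _ _ _ _ _ _ _ (dg a al)) -gE.
Qed.

(** The second difference over the parallelogram of sides s u and s w is symmetric in [u] and [w].
    It equals s^2 times either mixed derivative at some point near [x], and both derivatives are
    continuous there. *)
Lemma mixed_derivative_sym f x u w :
  (\forall y \near x, derivable f y u /\ derivable ('D_u f) y w) ->
  (\forall y \near x, derivable f y w /\ derivable ('D_w f) y u) ->
  {for x, continuous ('D_w ('D_u f))} -> {for x, continuous ('D_u ('D_w f))} ->
  'D_w ('D_u f) x = 'D_u ('D_w f) x.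
Proof.
have close2 (a b c d e : R) : c = d -> `|a - c| <= e / 2 -> `|b - d| <= e / 2 ->
    `|a - b| <= e.
  by move=> ->; rewrite !ler_norml => /andP[? ?] /andP[? ?]; apply/andP; lra.
move=> duw dwu cuw cwu; apply/eqP; rewrite -subr_eq0 -normr_le0.
apply/ler_addgt0Pr => e e0; rewrite add0r.
have e20 : 0 < e / 2 by rewrite divr_gt0.
have : \forall y \near x, [/\ derivable f y u /\ derivable ('D_u f) y w,
   derivable f y w /\ derivable ('D_w f) y u,
   `|'D_w ('D_u f) x - 'D_w ('D_u f) y| <= e / 2 &
   `|'D_u ('D_w f) x - 'D_u ('D_w f) y| <= e / 2].
  move/cvgrPdist_le : cuw => /(_ _ e20) cuw.
  move/cvgrPdist_le : cwu => /(_ _ e20) cwu.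
  apply: filterS2 (filterI duw dwu) (filterI cuw cwu) => y [a b] [c d].
  exact: And4 a b c d.
move=> /nbhs_ballP[r /= r0 rP].
pose k := `|u| + `|w| + 1.
have k0 : 0 < k by rewrite ltr_wpDl// addr_ge0.
pose s := r / k.
have s0 : 0 < s by rewrite divr_gt0.
have sr : s * (`|u| + `|w|) < r.
  by rewrite /s mulrAC ltr_pdivrMr// ltr_pM2l// ltrDl.
have sr' : s * (`|w| + `|u|) < r by rewrite [_ + `|u|]addrC.
have [y yx yE] := mixed_difference (ltW s0) sr
  (fun y yr => let: And4 a _ _ _ := rP y yr in a).
have [z zx zE] := mixed_difference (ltW s0) sr'
  (fun y yr => let: And4 _ a _ _ := rP y yr in a).
have {yE zE} yz : 'D_w ('D_u f) y = 'D_u ('D_w f) z.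
  apply: (mulfI (lt0r_neq0 s0)); apply: (mulfI (lt0r_neq0 s0)).
  apply: etrans (esym yE) (etrans _ zE); rewrite (addrAC x (s *: w)).
  move: (f _) (f _) (f _) (f _) => a1 a2 a3 a4; ring.
have yr : ball x r y by rewrite -ball_normE; exact: le_lt_trans sr.
have zr : ball x r z by rewrite -ball_normE; exact: le_lt_trans sr'.
have [_ _ le1 _] := rP y yr; have [_ _ _ le2] := rP z zr.
exact: close2 yz le1 le2.
Qed.

End directional.

(** Induction on the coordinates of [xi], adding one basis direction at a time with
    [is_derive_add]. *)
Lemma is_derive_gradient (R : realType) (n : nat) (f : 'rV[R]_n.+1 -> R)
    (x xi : 'rV[R]_n.+1) :
  (forall i, \forall y \near x, derivable f y (basis_vec i)) ->
  (forall i, {for x, continuous ('D_(basis_vec i) f)}) ->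
  is_derive x xi f (\sum_i xi 0 i * 'D_(basis_vec i) f x).
Proof.
move=> df cf; rewrite [X in is_derive _ X]row_sum_delta.
elim/big_rec2 : _ => [|i d w _ [dw <-]]; first exact: is_derive0.
rewrite addrC [X in is_derive _ _ _ X]addrC.
apply: is_derive_add; [exact: df|exact: cf|exact: dw].
Qed.

(** If [d2] were positive, [dh] would be positive just to the right of its zero 0, and the mean
    value theorem would give h t > h 0 there. *)
Lemma second_derivative_test (R : realType) (h dh : R -> R) (d2 : R) :
  (\forall t \near 0, is_derive t (1 : R) h (dh t)) ->
  is_derive (0 : R) (1 : R) dh d2 ->
  (\forall t \near 0, h t <= h 0) -> dh 0 = 0 /\ d2 <= 0.
Proof.
move=> dhP [dd d2E] hmax.
have : \forall t \near (0 : R), is_derive t (1 : R) h (dh t) /\ h t <= h 0.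
  by apply: filterI.
move=> /nbhs_ballP[r /= r0 rP].
have dh0 : dh 0 = 0.
  have [d0 _] := rP _ (ballxx 0 r0).
  rewrite -(@derive_val _ _ _ _ _ _ _ d0).
  have inr t : t \in `]- r, r[%R -> ball 0 r t.
    by rewrite in_itv/= -ball_normE/= sub0r normrN ltr_norml.
  apply: (@derive_val _ _ _ _ _ _ _ (@derive1_at_max _ h (- r) r 0 _ _ _ _)).
  - by rewrite ge0_cp ?ltW.
  - by move=> t /inr/rP[? _]; exact: ex_derive.
  - by rewrite in_itv/= oppr_lt0 r0.
  - by move=> t /inr/rP[].
split=> //; rewrite leNgt; apply/negP => d20.
have : \forall t \near 0^', 0 < t^-1 *: ((dh \o shift 0) (t *: 1) - dh 0).
  by apply: cvgr_gt dd _ _; rewrite -/(derive _ _ _) d2E.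
move=> /nbhs_ballP[r' /= r'0 r'P].
pose t := Num.min r r' / 2.
have m0 : 0 < Num.min r r' by rewrite lt_min r0.
have t0 : 0 < t by rewrite divr_gt0.
have [tr tr'] : t < r /\ t < r'.
  by apply/andP; rewrite -lt_min /t ltr_pdivrMr// ltr_pMr// ltr1n.
have inr s : s \in `[0, t]%R -> is_derive s (1 : R) h (dh s).
  rewrite in_itv/= => /andP[s0 st]; have [] := rP s => //.
  by rewrite -ball_normE/= sub0r normrN ger0_norm// (le_lt_trans st).
have [s st hE] := @MVT _ h dh _ _ t0 (fun s st => inr s (subset_itv_oo_cc st))
  (derivable1_continuous_within inr).
have [_] : is_derive t (1 : R) h (dh t) /\ h t <= h 0.
  by apply: rP; rewrite -ball_normE/= sub0r normrN gtr0_norm.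
rewrite -subr_le0 hE subr0 pmulr_lle0// => dhs0.
move: st; rewrite in_itv/= => /andP[s0 st].
have := r'P s; rewrite /= -ball_normE/= sub0r normrN gtr0_norm// dh0 subr0.
rewrite gt_eqF// => /(_ (lt_trans st tr') isT).
by rewrite addr0 [s *: 1]mulr1 pmulr_rgt0 ?invr_gt0// ltNge dhs0.
Qed.

(** * The half ball and functions that are C^2 up to its boundary *)

Section geometry.
Variables (R : realType) (n : nat).
Implicit Types x y xi : 'rV[R]_n.+1.

Lemma enormE x : enorm x = Num.sqrt (dot x x).
Proof. by congr (Num.sqrt _); apply: eq_bigr => i _; rewrite expr2. Qed.

Lemma sqr_enorm x : enorm x ^+ 2 = dot x x.
Proof. by rewrite enormE sqr_sqrtr// dot_ge0. Qed.

Lemma enorm_ge0 x : 0 <= enorm x.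
Proof. exact: sqrtr_ge0. Qed.

Lemma le_coord_enorm x i : `|x 0 i| <= enorm x.
Proof.
rewrite enormE -sqrtr_sqr ler_wsqrtr// /dot (bigD1 i)//= -expr2 lerDl.
by apply: sumr_ge0 => j _; rewrite -expr2 sqr_ge0.
Qed.

Lemma enorm_gt0 x : (0 < enorm x) = (x != 0).
Proof.
apply/idP/idP => [|x0]; first apply: contraTneq => ->.
  by rewrite enormE /dot big1 ?sqrtr0 ?ltxx// => i _; rewrite mxE mul0r.
rewrite lt_def enorm_ge0 andbT; apply: contraNneq x0 => x0.
apply/eqP/rowP => i; rewrite mxE; apply/eqP; rewrite -normr_le0 -x0.
exact: le_coord_enorm.
Qed.

Lemma enorm_continuous : continuous (@enorm R n).
Proof.
have sc (s : seq 'I_n.+1) :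
    continuous (fun x : 'rV[R]_n.+1 => \sum_(i <- s) x 0 i ^+ 2).
  elim: s => [|i s IHs] x.
    rewrite (_ : (fun x => _) = cst 0); first exact: cst_continuous.
    by apply/funext => y; rewrite big_nil.
  rewrite (_ : (fun x : 'rV[R]_n.+1 => _) =
    (fun x : 'rV[R]_n.+1 => x 0 i ^+ 2) +
    (fun x : 'rV[R]_n.+1 => \sum_(i <- s) x 0 i ^+ 2)).
    apply: continuousD; last exact: IHs.
    rewrite (_ : (fun x : 'rV[R]_n.+1 => x 0 i ^+ 2) =
      (fun x => x 0 i) * (fun x => x 0 i)).
      by apply: continuousM; exact: coord_continuous.
    by apply/funext => y; rewrite expr2.
  by apply/funext => y; rewrite big_cons.
move=> x; apply: (@continuous_comp _ _ _
  (fun x : 'rV[R]_n.+1 => \sum_i x 0 i ^+ 2) Num.sqrt); first exact: sc.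
exact: sqrt_continuous.
Qed.

Lemma open_half_ball : open (@half_ball R n).
Proof.
rewrite (_ : half_ball = (@enorm R n) @^-1` [set y | y < 1] `&`
   (fun x : 'rV[R]_n.+1 => x 0 ord_max) @^-1` [set y | 0 < y])//.
apply: openI; apply: open_comp; [|exact: open_lt| |exact: open_gt].
- by move=> x _; exact: enorm_continuous.
- by move=> x _; exact: coord_continuous.
Qed.

Lemma closure_half_ball x : closure half_ball x -> 0 <= x 0 ord_max.
Proof.
have cl : closed ((fun x : 'rV[R]_n.+1 => x 0 ord_max) @^-1` [set y | 0 <= y]).
  by apply: closed_comp => [y _|]; [exact: coord_continuous|exact: closed_ge].
rewrite -[X in _ -> X]/(((fun x : 'rV[R]_n.+1 => x 0 ord_max) @^-1`
  [set y | 0 <= y]) x) [X in _ -> X x]((closure_id _).1 cl).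
by apply: closure_subset => y [_ /ltW].
Qed.

Lemma line_continuous x xi : continuous (fun h : R => x + h *: xi).
Proof.
move=> h; apply: cvgD; first exact: cvg_cst.
exact: scalel_continuous.
Qed.

Lemma half_ball_closure x : enorm x < 1 -> 0 <= x 0 ord_max ->
  closure half_ball x.
Proof.
move=> x1 x0 B Bx.
suff : \forall h \near (0 : R)^'+,
    (half_ball `&` B) (x + h *: basis_vec ord_max).
  by move=> /filter_ex[h Bh]; exists (x + h *: basis_vec ord_max).
have lc : x + h *: basis_vec ord_max @[h --> (0 : R)] --> x.
  have := @line_continuous x (basis_vec ord_max) 0.
  by rewrite /continuous_at scale0r addr0.
have lr := cvg_at_right_filter lc.
have l1 : \forall y \near x, enorm y < 1.
  exact: (@enorm_continuous x [set y | y < 1]) (lt_nbhsl x1).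
have lr1 : \forall h \near (0 : R)^'+, enorm (x + h *: basis_vec ord_max) < 1.
  exact: lr _ l1.
near=> h; split; last by near: h; exact: lr.
split; first by near: h; exact: lr1.
by rewrite !mxE !eqxx mulr1 ltr_wpDl//; near: h; exact: nbhs_right_gt.
Unshelve. all: by end_near. Qed.

End geometry.

(** * Derivatives in the half ball and at its flat boundary *)

Section regularity.
Variables (R : realType) (n : nat).
Implicit Types (x y xi : 'rV[R]_n.+1) (f : 'rV[R]_n.+1 -> R).

Lemma half_ball_punctured : @half_ball R n `<=` punctured_half_ball.
Proof.
move=> x hx; split; first exact: subset_closure.
by move=> /= x0; case: hx; rewrite x0 mxE ltxx.
Qed.

Lemma near_half_ball x : half_ball x -> \forall y \near x, half_ball y.
Proof. by move=> hx; apply: open_nbhs_nbhs; split => //; exact: open_half_ball. Qed.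

Lemma extends_continuous f x :
  extends_continuously half_ball punctured_half_ball f -> half_ball x ->
  {for x, continuous f}.
Proof.
move=> [g cg fg] hx.
have cgx : {for x, continuous g}.
  have := continuous_subspaceW half_ball_punctured cg.
  by rewrite continuous_open_subspace; [apply; rewrite inE|exact: open_half_ball].
have gf : {near x, g =1 f} by apply: filterS (near_half_ball hx) => y /fg.
by rewrite /prop_for /continuous_at fg//; exact: cvg_trans (near_eq_cvg gf) cgx.
Qed.

Variable v : 'rV[R]_n.+1 -> R.
Hypothesis v_C2 : C2_up_to_boundary half_ball punctured_half_ball v.

Lemma hessian_sym x : half_ball x -> (hessian v x)^T = hessian v x.
Proof.
case: v_C2 => _ d1 _ d2 c2 hx.
apply/matrixP => i j; rewrite !mxE; apply: mixed_derivative_sym.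
- by apply: filterS (near_half_ball hx) => y hy; exact: conj (d1 _ _ hy) (d2 _ _ _ hy).
- by apply: filterS (near_half_ball hx) => y hy; exact: conj (d1 _ _ hy) (d2 _ _ _ hy).
- exact: extends_continuous (c2 _ _) hx.
- exact: extends_continuous (c2 _ _) hx.
Qed.

Lemma is_derive_line_gradient x xi (t : R) : half_ball (x + t *: xi) ->
  is_derive t (1 : R) (fun s => v (x + s *: xi))
    (dot xi (gradient v (x + t *: xi))).
Proof.
case: v_C2 => _ d1 c1 _ _ hx; apply: is_derive_line.
rewrite (_ : dot _ _ =
  \sum_i xi 0 i * 'D_(basis_vec i) v (x + t *: xi)); last first.
  by apply: eq_bigr => i _; rewrite mxE.
apply: is_derive_gradient => i.
  by apply: filterS (near_half_ball hx) => y hy; exact: d1.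
exact: extends_continuous (c1 _) hx.
Qed.

Lemma is_derive_line_hessian x xi : half_ball x ->
  is_derive (0 : R) (1 : R) (fun t => dot xi (gradient v (x + t *: xi)))
    (qform (hessian v x) xi).
Proof.
case: v_C2 => _ _ _ d2 c2 hx.
have d i : is_derive (0 : R) (1 : R)
   (xi 0 i \*: (fun t => 'D_(basis_vec i) v (x + t *: xi)))
   (xi 0 i *: \sum_j xi 0 j * 'D_(basis_vec j) ('D_(basis_vec i) v) x).
  apply: is_deriveZ; apply: (@is_derive_line _ _ ('D_(basis_vec i) v)); rewrite scale0r addr0.
  apply: is_derive_gradient => j.
    by apply: filterS (near_half_ball hx) => y hy; exact: d2.
  exact: extends_continuous (c2 _ _) hx.
have -> : (fun t : R => dot xi (gradient v (x + t *: xi))) =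
    \sum_i (xi 0 i \*: (fun t => 'D_(basis_vec i) v (x + t *: xi))).
  by apply/funext => t; rewrite fct_sumE; apply: eq_bigr => i _; rewrite mxE.
have -> : qform (hessian v x) xi = \sum_i (xi 0 i *:
    \sum_j xi 0 j * 'D_(basis_vec j) ('D_(basis_vec i) v) x).
  rewrite /qform; under eq_bigr do rewrite mulr_suml.
  rewrite exchange_big; apply: eq_bigr => i _.
  rewrite [RHS]mulr_sumr; apply: eq_bigr => j _.
  by rewrite !mxE mulrAC -mulrA.
exact: is_derive_sum.
Qed.

Lemma flat_line x (t : R) : flat_boundary x -> x != 0 -> 0 <= t ->
  enorm (x + t *: basis_vec ord_max) < 1 ->
  punctured_half_ball (x + t *: basis_vec ord_max).
Proof.
move=> [x1 xn] x0 t0 xt1.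
have E : (x + t *: basis_vec ord_max) 0 ord_max = t.
  by rewrite !mxE !eqxx mulr1 xn add0r.
split; first by apply: half_ball_closure; rewrite ?E.
move=> /= xt; move: E; rewrite xt mxE => E; move: xt.
by rewrite -E scale0r addr0 => /eqP; rewrite (negbTE x0).
Qed.

(** [normal_derivative] is a [lim], informative only under convergence. By the mean value theorem
    the quotient is the value, at an intermediate point, of the continuous extension of the last
    partial derivative. *)
Lemma normal_derivative_cvg x : (flat_boundary `\` [set 0]) x ->
  cvg (h^-1 * (v (x + h *: basis_vec ord_max) - v x) @[h --> (0 : R)^'+]).
Proof.
case: v_C2 => cv d1 c1 _ _ [fx /eqP x0].
have [g cg vg] := c1 ord_max.
apply/cvg_ex; exists (g x); apply/cvgrPdist_le => e e0.
have [x1 xn] := fx.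
pose l (h : R) := x + h *: basis_vec ord_max.
have lc : continuous l := @line_continuous _ _ _ _.
have Ex : punctured_half_ball x.
  by have := @flat_line x 0 fx x0 (lexx _); rewrite scale0r addr0; exact.
have : \forall h \near (0 : R), enorm (l h) < 1 /\
    (punctured_half_ball (l h) -> `|g x - g (l h)| <= e).
  have l0 : l h @[h --> (0 : R)] --> x.
    by have := lc 0; rewrite /continuous_at {2}/l scale0r addr0.
  apply: filterI.
    by apply: (l0 [set y | enorm y < 1]);
      exact: (@enorm_continuous _ _ x [set y | y < 1]) (lt_nbhsl x1).
  move/subspace_continuousP : cg => /(_ x Ex)/cvgrPdist_le/(_ e e0) cg.
  exact: (l0 _ cg).
move=> /nbhs_ballP[r /= r0 rP].
near=> h.
have h0 : 0 < h by near: h; exact: nbhs_right_gt.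
have hr : h < r by near: h; exact: nbhs_right_lt.
have inr t : 0 <= t <= h -> ball 0 r t.
  move=> /andP[t0 th]; rewrite -ball_normE/= sub0r normrN ger0_norm//.
  exact: le_lt_trans hr.
have inE' t : 0 <= t <= h -> punctured_half_ball (l t).
  by move=> th; apply: flat_line => //; [case/andP: th|case: (rP _ (inr _ th))].
have inU t : 0 < t -> t <= h -> half_ball (l t).
  move=> t0 th; split; first by case: (rP t (inr _ _)); rewrite ?(ltW t0)//.
  by rewrite !mxE !eqxx mulr1 xn add0r.
have dv t : t \in `]0, h[%R ->
    is_derive t (1 : R) (fun s => v (l s)) ('D_(basis_vec ord_max) v (l t)).
  rewrite in_itv/= => /andP[t0 th]; apply: is_derive_line; apply/derivableP.
  exact: d1 (inU _ t0 (ltW th)).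
(* The segment starts on the flat boundary, where [v] is only continuous relative to the punctured
   half ball. *)
have cvl : {within `[0, h], continuous (fun s => v (l s))}.
  apply/subspace_continuousP => t /=; rewrite in_itv/= => th.
  move/subspace_continuousP : cv => /(_ _ (inE' _ th)) cvt.
  suff lt : l s @[s --> within `[0, h]%classic (nbhs t)] -->
      within punctured_half_ball (nbhs (l t)) by exact: cvg_comp lt cvt.
  move=> B EB.
  have EB' : nbhs (l t) [set y | punctured_half_ball y -> B y] := EB.
  have lB : \forall u \near t, punctured_half_ball (l u) -> B (l u) := lc t _ EB'.
  rewrite /within; apply: filterS lB => u + uh; apply; apply: inE'.
  by rewrite /= in_itv in uh.
have [t tin vE] := MVT h0 dv cvl.
have [t0 th] : 0 < t /\ t < h by apply/andP; rewrite in_itv/= in tin.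
have th' : 0 <= t <= h by rewrite !ltW.
have := (rP _ (inr _ th')).2 (inE' _ th').
have l0x : l 0 = x by rewrite /l scale0r addr0.
rewrite l0x subr0 in vE.
have -> : h^-1 * (v (x + h *: basis_vec ord_max) - v x) = g (l t).
  rewrite -/(l h) vE mulrCA mulVf ?gt_eqF// mulr1.
  by apply: vg; apply: inU => //; exact: ltW.
by [].
Unshelve. all: by end_near. Qed.
End regularity.

(** * The barrier *)

Section barrier.
Variables (R : realType) (n : nat).
Implicit Types x xi : 'rV[R]_n.+1.

Definition barrier (dl k : R) x : R :=
  1 + dl * ln (enorm x) + enorm x + k * x 0 ord_max.

Lemma is_derive_dot_line x xi (t : R) :
  is_derive t (1 : R) (fun s => dot xi (x + s *: xi)) (dot xi xi).
Proof.
rewrite (_ : (fun s => _) = cst (dot xi x) + (dot xi xi \*: id)).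
  apply: (@is_derive_eq _ _ _ _ _ _ _ _ (is_deriveD
    (is_derive_cst (dot xi x) t 1) (is_deriveZ (dot xi xi) (is_derive_id t 1)))).
  by rewrite add0r [_ *: _]mulr1.
by apply/funext => s; rewrite dotDr dotZr mulrC.
Qed.

Lemma is_derive_enorm_line x xi (t : R) : x + t *: xi != 0 ->
  is_derive t (1 : R) (fun s => enorm (x + s *: xi))
    (dot xi (x + t *: xi) / enorm (x + t *: xi)).
Proof.
move=> x0.
have -> : (fun s : R => enorm (x + s *: xi)) =
   Num.sqrt \o (fun s => dot (x + s *: xi) (x + s *: xi)).
  by apply/funext => s; rewrite /= enormE.
have d1 : is_derive t (1 : R) (fun s => dot (x + s *: xi) (x + s *: xi))
   (2 * dot xi (x + t *: xi)).
  rewrite (_ : (fun s => _) = cst (dot x x) + ((2 * dot xi x) \*: id)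
    + (dot xi xi \*: (id * id))).
    apply: (@is_derive_eq _ _ _ _ _ _ _ _ (is_deriveD (is_deriveD
      (is_derive_cst (dot x x) t 1)
      (is_deriveZ (2 * dot xi x) (is_derive_id t 1)))
      (is_deriveZ (dot xi xi) (is_deriveM (is_derive_id t 1) (is_derive_id t 1))))).
    by rewrite dotDr dotZr /= add0r /GRing.scale/=; ring.
  apply/funext => s; rewrite !(dotDl, dotDr, dotZl, dotZr) (dotC x xi).
  rewrite -[RHS]/(dot x x + (2 * dot xi x) * s + dot xi xi * (s * s)).
  by ring.
have dot0 : 0 < dot (x + t *: xi) (x + t *: xi).
  by rewrite -sqr_enorm exprn_gt0// enorm_gt0.
apply: (@is_derive_eq _ _ _ _ _ _ _ _ (is_derive1_comp (is_derive1_sqrt dot0) d1)).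
by rewrite -enormE; field; rewrite lt0r_neq0 ?enorm_gt0.
Qed.

(** This is phi'(r) / r for phi(r) = dl ln r + r, so the radial part of the barrier has gradient
    [radial_slope] times x. *)
Definition radial_slope (dl r : R) := dl / r ^+ 2 + r^-1.

Lemma is_derive_log_profile (r : R -> R) (dl p q t b : R) :
  is_derive t (1 : R) r (b / r t) -> 0 < r t ->
  is_derive t (1 : R) (fun s => 1 + dl * ln (r s) + r s + (p + q * s))
    (b * radial_slope dl (r t) + q).
Proof.
move=> dr r0.
have dln := is_deriveZ dl (is_derive1_comp (is_derive1_ln r0) dr).
have dlin := is_deriveD (is_derive_cst p t 1) (is_deriveZ q (is_derive_id t 1)).
apply: (@is_derive_eq _ _ _ _ _ _ _ _
  (is_deriveD (is_deriveD (is_deriveD (is_derive_cst (1 : R) t 1) dln) dr) dlin)).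
by rewrite /GRing.scale/= /radial_slope; field; exact: lt0r_neq0.
Qed.

(** The factor 2 dl / r^4 + 1 / r^3 is minus the derivative of [radial_slope] divided by r. *)
Lemma is_derive_radial_slope (r b : R -> R) (dl q t db : R) :
  is_derive t (1 : R) r (b t / r t) -> is_derive t (1 : R) b db -> 0 < r t ->
  is_derive t (1 : R) (fun s => b s * radial_slope dl (r s) + q)
    (db * radial_slope dl (r t)
     - b t ^+ 2 * (2 * dl / r t ^+ 4 + (r t ^+ 3)^-1)).
Proof.
move=> dr dbt r0.
have di := is_deriveV (lt0r_neq0 r0) dr.
have dq := is_deriveD (is_deriveZ dl (is_deriveM di di)) di.
rewrite (_ : (fun s => _) = b * (dl \*: ((fun y => (r y)^-1) *
   (fun y => (r y)^-1)) + (fun y => (r y)^-1)) + cst q); last first.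
  by apply/funext => s; rewrite /radial_slope expr2 invfM.
apply: (@is_derive_eq _ _ _ _ _ _ _ _
  (is_deriveD (is_deriveM dbt dq) (is_derive_cst q t 1))).
rewrite /GRing.scale/= -[X in X * db]/(dl * ((r t)^-1 * (r t)^-1) + (r t)^-1).
by rewrite /radial_slope; field; exact: lt0r_neq0.
Qed.

Lemma is_derive_barrier_line dl k x xi (t : R) : x + t *: xi != 0 ->
  is_derive t (1 : R) (fun s => barrier dl k (x + s *: xi))
    (dot xi (x + t *: xi) * radial_slope dl (enorm (x + t *: xi))
     + k * xi 0 ord_max).
Proof.
move=> x0.
have r0 : 0 < enorm (x + t *: xi) by rewrite enorm_gt0.
have -> : (fun s => barrier dl k (x + s *: xi)) =
    (fun s => 1 + dl * ln (enorm (x + s *: xi)) + enorm (x + s *: xi)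
              + (k * x 0 ord_max + k * xi 0 ord_max * s)).
  by apply/funext => s; rewrite /barrier !mxE; ring.
exact: (@is_derive_log_profile (fun s => enorm (x + s *: xi))
  dl (k * x 0 ord_max) (k * xi 0 ord_max) t _ (is_derive_enorm_line x0) r0).
Qed.

Lemma is_derive_barrier_line2 dl k x xi : x != 0 ->
  is_derive (0 : R) (1 : R) (fun t =>
     dot xi (x + t *: xi) * radial_slope dl (enorm (x + t *: xi))
     + k * xi 0 ord_max)
   (dot xi xi * radial_slope dl (enorm x)
    - dot xi x ^+ 2 * (2 * dl / enorm x ^+ 4 + (enorm x ^+ 3)^-1)).
Proof.
move=> x0.
have E : x + (0 : R) *: xi = x by rewrite scale0r addr0.
have x0' : x + (0 : R) *: xi != 0 by rewrite E.
have r0 : 0 < enorm (x + (0 : R) *: xi) by rewrite enorm_gt0.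
have := @is_derive_radial_slope (fun t => enorm (x + t *: xi))
  (fun t => dot xi (x + t *: xi)) dl (k * xi 0 ord_max) 0 _
  (is_derive_enorm_line x0') (is_derive_dot_line x xi 0) r0.
by rewrite E.
Qed.
End barrier.

(** * Comparison with the barrier *)

(** First and second derivative tests for W e^{-kV}, divided by the positive exponential; the
    first-order identity turns k^2 W V'^2 into k W' V'. Avoiding ln W leaves the sign of [W]
    free. *)
Lemma touching_at_max (R : realType) (W V dW dV : R -> R) (d2W d2V k : R) :
  (\forall t \near 0, is_derive t (1 : R) W (dW t)) ->
  (\forall t \near 0, is_derive t (1 : R) V (dV t)) ->
  is_derive (0 : R) (1 : R) dW d2W -> is_derive (0 : R) (1 : R) dV d2V ->
  (\forall t \near 0, W t * expR (- k * V t) <= W 0 * expR (- k * V 0)) ->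
  dW 0 = k * W 0 * dV 0 /\ d2W <= k * (dW 0 * dV 0 + W 0 * d2V).
Proof.
move=> dWP dVP dW0 dV0 maxP; pose E t := expR (- k * V t).
have dE t : is_derive t (1 : R) V (dV t) ->
    is_derive t (1 : R) E (E t * (- k * dV t)).
  move=> dVt; exact: (@is_derive1_comp R expR (fun t => - k * V t) t _ _
    (is_derive_expR _) (is_deriveZ (- k) dVt)).
have dVn := nbhs_singleton dVP; have dWn := nbhs_singleton dWP.
pose dH := W * (E * (- k \*: dV)) + E * dW.
have dHP : \forall t \near 0, is_derive t (1 : R) (W * E) (dH t).
  apply: filterS2 dWP dVP => t dWt dVt.
  exact: is_deriveM dWt (dE t dVt).
have [dH0 le0] :
    W 0 * (E 0 * (- k * dV 0)) + E 0 * dW 0 = 0 /\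
    W 0 * (E 0 * (- k * d2V) + (- k * dV 0) * (E 0 * (- k * dV 0))) +
      (E 0 * (- k * dV 0)) * dW 0 +
    (E 0 * d2W + dW 0 * (E 0 * (- k * dV 0))) <= 0 :=
  second_derivative_test dHP (is_deriveD
   (is_deriveM dWn (is_deriveM (dE 0 dVn) (is_deriveZ (- k) dV0)))
   (is_deriveM (dE 0 dVn) dW0)) maxP.
have E0 : 0 < E 0 by exact: expR_gt0.
have dW0E : dW 0 = k * W 0 * dV 0.
  have : E 0 * (dW 0 - k * W 0 * dV 0) = 0 by apply: etrans dH0; ring.
  by move/eqP; rewrite mulf_eq0 gt_eqF//= subr_eq0 => /eqP.
split=> //.
rewrite -subr_le0 -(pmulr_rle0 _ E0); apply: le_trans le0.
by rewrite le_eqVlt dW0E; apply/orP; left; apply/eqP; ring.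
Qed.

(** The gradient of [v] will be a e + b e_N with e = x / |x|. Here [X], [q] and [pu] are the
    products of a test vector u with e, e_N and the gradient, [C] and [pp] the square norms of u and
    of the gradient, and [h] the Hessian form at u. The tilt [b] is absorbed thanks to b <= k a. *)
Lemma quadratic_estimate (R : realFieldType) (k a b sg X q C pu pp h : R) :
  0 < k -> 0 <= b <= k * a -> q ^+ 2 <= C -> pu = X * a + q * b ->
  a ^+ 2 <= pp -> - h <= - (C * sg) + 2 * sg * X ^+ 2 + k * pu ^+ 2 ->
  - h + pu ^+ 2 - 2^-1 * pp * C <=
    - (sg + a ^+ 2 * (2^-1 - (1 + k) ^+ 2 * k)) * C +
    (2 * sg + (1 + k) ^+ 2 * a ^+ 2) * X ^+ 2.
Proof.
move=> k0 /andP[b0 bka] qC puE app hle.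
have C0 : 0 <= C by exact: le_trans (sqr_ge0 q) qC.
have bqC : (b * q) ^+ 2 <= k ^+ 2 * a ^+ 2 * C.
  rewrite exprMn -[k ^+ 2 * a ^+ 2]exprMn; apply: ler_pM; rewrite ?sqr_ge0//.
  by rewrite ler_pXn2r ?nnegrE// (le_trans b0).
(* Young's inequality with weights 1 + k and 1 + 1 / k, multiplied by [k] to clear the
   denominator. *)
have kpu : k * pu ^+ 2 <= k * ((1 + k) * (a ^+ 2 * X ^+ 2) + (1 + k) * k * (a ^+ 2 * C)).
  have := sqr_ge0 (k * a * X - b * q).
  have : 0 <= (1 + k) * (k ^+ 2 * a ^+ 2 * C - (b * q) ^+ 2).
    by rewrite mulr_ge0 ?subr_ge0// addr_ge0 ?ltW.
  by rewrite puE; lra.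
rewrite ler_pM2l// in kpu.
have : (1 + k) * pu ^+ 2 <= (1 + k) * ((1 + k) * (a ^+ 2 * X ^+ 2) + (1 + k) * k * (a ^+ 2 * C)).
  by rewrite ler_pM2l// addr_gt0.
have := ler_wpM2r C0 app.
lra.
Qed.

(** The last claim is s <= (2 + eta) t, checked separately on the coefficients of [sg] and of a^2.
    For a^2, with eta = 32 k, it follows from 1 + 3 k <= (2 + 32 k) (1 / 2 - 2 k), true for k <= 1 /
    32. *)
Lemma cone_aperture_estimate (R : realFieldType) (eta k a sg : R) :
  0 < eta <= 1 -> k = eta / 32 -> 0 < sg ->
  let t := sg + a ^+ 2 * (2^-1 - (1 + k) ^+ 2 * k) in
  let s := 2 * sg + (1 + k) ^+ 2 * a ^+ 2 in
  [/\ 0 < t, 0 <= s & s - t <= t * (1 + eta)].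
Proof.
move=> /andP[eta0 eta1] kE sg0 t s.
have k0 : 0 < k by rewrite kE divr_gt0.
have k1 : k <= 1 / 32 by rewrite kE; lra.
have k2 : (1 + k) ^+ 2 <= 1 + 3 * k by nra.
have k3 : (1 + k) ^+ 2 * k <= 2 * k by nra.
have a0 := sqr_ge0 a.
have k4 : (1 + k) ^+ 2 <= (2 + eta) * (2^-1 - (1 + k) ^+ 2 * k).
  have -> : eta = 32 * k by rewrite kE; field.
  nra.
split.
- by rewrite /t ltr_pwDl// mulr_ge0//; lra.
- by apply: addr_ge0; apply: mulr_ge0; rewrite ?sqr_ge0 ?ler0n ?(ltW sg0).
- have := ler_wpM2r a0 k4; rewrite /s /t.
  have : 0 <= eta * sg by rewrite mulr_ge0 ?(ltW eta0) ?(ltW sg0).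
  lra.
Qed.

(** * Maximum of the weight at an interior point *)

Section interior.
Variables (R : realType) (n : nat).
Implicit Types (x u xi : 'rV[R]_n.+1).

Lemma dot_basis_vec i x : dot (basis_vec i) x = x 0 i.
Proof.
rewrite /dot (bigD1 i)//= big1 ?addr0 => [|j ji]; rewrite !mxE !eqxx /=.
  by rewrite mul1r.
by rewrite (negbTE ji) mul0r.
Qed.

Lemma qform_conformal_hessian (v : 'rV[R]_n.+1 -> R) x u :
  let p := gradient v x in
  qform (conformal_hessian v x) u = expR (- 2 * v x) *
    (- qform (hessian v x) u + dot u p ^+ 2 - 2^-1 * dot p p * dot u u).
Proof.
move=> p; rewrite /conformal_hessian -/p sqr_enorm.
set E := expR _; set H := hessian v x; set m := 2^-1 * _.
have inner j : \sum_i u 0 i * (E *: (- H + p^T *m p - m%:M)) i j =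
    E * (- (\sum_i u 0 i * H i j) + dot u p * p 0 j - m * u 0 j).
  have -> : m * u 0 j = \sum_i u 0 i * (m%:M : 'M[R]_n.+1) i j.
    rewrite (bigD1 j)//= big1 ?addr0 => [|i ij]; rewrite mxE ?eqxx ?mulr1n 1?mulrC//.
    by rewrite (negbTE ij) mulr0n mul0r.
  rewrite mulr_suml -sumrN -big_split -sumrB mulr_sumr; apply: eq_bigr => i _.
  by rewrite !mxE big_ord1 !mxE /=; ring.
rewrite /qform; under eq_bigr do rewrite inner.
have -> : dot u p ^+ 2 = \sum_j dot u p * (u 0 j * p 0 j) by rewrite -mulr_sumr.
rewrite [dot u u]/dot mulr_sumr -sumrN -big_split -sumrB.
rewrite mulr_sumr; apply: eq_bigr => j _ /=; ring.
Qed.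

Lemma conformal_hessian_sym (v : 'rV[R]_n.+1 -> R) x :
  (hessian v x)^T = hessian v x ->
  (conformal_hessian v x)^T = conformal_hessian v x.
Proof.
move=> Hs; rewrite /conformal_hessian linearZ/= !linearB/= !linearD/= linearN/=.
by rewrite Hs trmx_mul trmxK tr_scalar_mx.
Qed.

Variables (Gamma : set 'rV[R]_n.+1) (v : 'rV[R]_n.+1 -> R) (eta k dl : R).
Hypotheses (v_C2 : C2_up_to_boundary half_ball punctured_half_ball v)
  (eta01 : 0 < eta <= 1) (kE : k = eta / 32) (dl0 : 0 < dl)
  (Gamma_eta : forall (lam : 'rV[R]_n.+1) t (q : 'S_n.+1), 0 < t ->
   (forall i, lam 0 (q i) <= (if i == ord0 then t * (1 + eta) else - t)) ->
   ~ closure Gamma lam).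

(** The tests along all lines through [x] determine the gradient and bound the Hessian from below.
    They yield a bound of A[v] by a negative scalar plus a multiple of e e^T, e = x / |x|, which
    [Gamma_eta] excludes. *)
Lemma no_interior_touching x : half_ball x -> 0 < barrier dl k x ->
  (\forall y \near x, barrier dl k y * expR (- k * v y) <=
                     barrier dl k x * expR (- k * v x)) ->
  ~ eigenvalues_in (conformal_hessian v x) (closure Gamma).
Proof.
move=> hx w0 maxP [lam lamP Glam].
set w := barrier dl k x in w0; set p := gradient v x.
set r := enorm x; set S := radial_slope dl r; set H := hessian v x.
have k0 : 0 < k by rewrite kE divr_gt0//; case/andP: eta01.
have x0 : x != 0.
  by apply/eqP => x0; case: hx => _; rewrite x0 mxE ltxx.
have r0 : 0 < r by rewrite enorm_gt0.
have S0 : 0 < S by rewrite addr_gt0 ?invr_gt0// divr_gt0// exprn_gt0.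
have line0 xi : x + (0 : R) *: xi = x by rewrite scale0r addr0.
have near_line xi (P : set 'rV[R]_n.+1) : (\forall y \near x, P y) ->
    \forall t \near (0 : R), P (x + t *: xi).
  move=> nP; have := @line_continuous _ _ x xi 0.
  by rewrite /continuous_at line0; apply.
have touch xi : k * w * dot xi p = dot xi x * S + k * xi 0 ord_max /\
    dot xi xi * S - dot xi x ^+ 2 * (2 * dl / r ^+ 4 + (r ^+ 3)^-1) <=
    k * ((dot xi x * S + k * xi 0 ord_max) * dot xi p + w * qform H xi).
  have dW : \forall t \near (0 : R), is_derive t (1 : R)
      (fun s => barrier dl k (x + s *: xi))
      (dot xi (x + t *: xi) * radial_slope dl (enorm (x + t *: xi))
       + k * xi 0 ord_max).
    apply: filterS (near_line xi _ (near_half_ball hx)) => t ht.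
    apply: is_derive_barrier_line.
    by apply/eqP => E; case: ht => _; rewrite E mxE ltxx.
  have dV : \forall t \near (0 : R), is_derive t (1 : R)
      (fun s => v (x + s *: xi)) (dot xi (gradient v (x + t *: xi))).
    apply: filterS (near_line xi _ (near_half_ball hx)) => t ht.
    exact: is_derive_line_gradient.
  have := touching_at_max dW dV (is_derive_barrier_line2 dl k xi x0)
    (is_derive_line_hessian v_C2 xi hx).
  rewrite !line0 => /(_ k (near_line xi _ maxP))[-> le2]; split => //.
(* The first-order identity in the basis directions: a radial part plus the tilt. *)
have pE i : p 0 i = (S / (k * w)) * x 0 i + w^-1 * (i == ord_max)%:R.
  have [+ _] := touch (basis_vec i); rewrite !dot_basis_vec => pE.
  have kw0 : k * w != 0 by rewrite mulf_neq0 ?gt_eqF.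
  apply: (mulfI kw0); rewrite pE !mxE eqxx /= eq_sym; field.
  by rewrite !gt_eqF.
have kw0 : 0 < k * w by exact: mulr_gt0.
pose sg := S / (k * w); pose a := r * sg; pose b := w^-1.
pose e := r^-1 *: x.
have sg0 : 0 < sg by exact: divr_gt0.
have dotp u : dot u p = sg * dot u x + b * u 0 ord_max.
  have -> : p = sg *: x + b *: basis_vec ord_max.
    by apply/rowP => i; rewrite pE !mxE eqxx.
  by rewrite dotDr !dotZr (dotC u (basis_vec _)) dot_basis_vec.
have xx : dot x x = r ^+ 2 by rewrite sqr_enorm.
(* Since x_N > 0, the tilt can only lengthen the gradient. *)
have app : a ^+ 2 <= dot p p.
  have -> : dot p p = a ^+ 2 + (2 * sg * b * x 0 ord_max + b ^+ 2).
    rewrite dotp (dotC p x) dotp xx pE eqxx mulr1 -/sg -/b /a; ring.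
  have xn : 0 < x 0 ord_max by case: hx.
  by rewrite lerDl addr_ge0 ?sqr_ge0// !mulr_ge0 ?invr_ge0// ltW.
(* Here k a w = r S = 1 + dl / r, while b w = 1; the term |x| of the barrier provides the 1. *)
have b0ka : 0 <= b <= k * a.
  rewrite invr_ge0 (ltW w0)/= -(ler_pM2r w0) mulVf ?gt_eqF//.
  have -> : k * a * w = 1 + dl / r.
    by rewrite /a /sg /S /radial_slope; field; rewrite !gt_eqF.
  by rewrite lerDl divr_ge0 ?ltW.
pose t := sg + a ^+ 2 * (2^-1 - (1 + k) ^+ 2 * k).
pose s := 2 * sg + (1 + k) ^+ 2 * a ^+ 2.
have [t0 s0 st] : [/\ 0 < t, 0 <= s & s - t <= t * (1 + eta)].
  exact: cone_aperture_estimate eta01 kE sg0.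
have quad u : - qform H u + dot u p ^+ 2 - 2^-1 * dot p p * dot u u <=
    - t * dot u u + s * dot u e ^+ 2.
  have Xr : dot u x = r * dot u e by rewrite dotZr mulVKf ?gt_eqF.
  apply: (@quadratic_estimate R k a b sg (dot u e) (u 0 ord_max) (dot u u)
    (dot u p) (dot p p) (qform H u)) => //.
  - rewrite -sqr_enorm -[_ ^+ 2]real_normK ?num_real// ler_pXn2r ?nnegrE//.
      exact: le_coord_enorm.
    exact: enorm_ge0.
  - by rewrite dotp Xr /a; ring.
  have [pu le2] := touch u.
  (* After extracting (u . e)^2, the coefficient 2 dl / r^2 + 1 / r is at most 2 S. *)
  have rad : dot u x ^+ 2 * (2 * dl / r ^+ 4 + (r ^+ 3)^-1) <=
      2 * S * dot u e ^+ 2.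
    have -> : dot u x ^+ 2 * (2 * dl / r ^+ 4 + (r ^+ 3)^-1) =
        2 * S * dot u e ^+ 2 - r^-1 * dot u e ^+ 2.
      by rewrite Xr /S /radial_slope; field; rewrite gt_eqF.
    by rewrite gerBl mulr_ge0 ?sqr_ge0// invr_ge0 ltW.
  rewrite -pu in le2.
  rewrite -(ler_pM2l kw0).
  have -> : k * w * (- (dot u u * sg) + 2 * sg * dot u e ^+ 2 + k * dot u p ^+ 2)
      = - (dot u u * S) + 2 * S * dot u e ^+ 2 + k * (k * w * dot u p * dot u p).
    by rewrite /sg; field; rewrite !gt_eqF.
  lra.
pose E := expR (- 2 * v x).
have E0 : 0 < E by exact: expR_gt0.
have e1 : dot e e = 1.
  by rewrite dotZl dotZr xx; field; rewrite gt_eqF.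
have M_le u : qform (conformal_hessian v x) u <=
    - (E * t) * dot u u + (E * s) * dot u e ^+ 2.
  rewrite qform_conformal_hessian -/p -/H -/E.
  have := quad u; rewrite -(ler_pM2l E0) => /le_trans; apply.
  by rewrite le_eqVlt; apply/orP; left; apply/eqP; ring.
have [q qP] := @eigenvalues_le_perm _ _ (conformal_hessian v x) lam e
  (E * t) (E * s) (conformal_hessian_sym (hessian_sym v_C2 hx)) lamP e1
  (mulr_ge0 (ltW E0) s0) M_le ord0.
apply: (Gamma_eta (t := E * t) (q := q)) Glam; first exact: mulr_gt0.
move=> i; apply: le_trans (qP i) _; case: eqP => // _.
by rewrite -mulrBr -mulrA ler_pM2l.
Qed.
End interior.

(** * Maximum of the weight on the flat boundary *)

Section boundary.
Variables (R : realType) (n : nat) (v : 'rV[R]_n.+1 -> R) (k dl : R).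
Hypotheses (v_C2 : C2_up_to_boundary half_ball punctured_half_ball v)
  (k0 : 0 < k) (dl0 : 0 < dl).
Implicit Types (x y : 'rV[R]_n.+1).

(** At a flat point the normal is orthogonal to [x], so moving along it does not decrease the norm;
    the tilt contributes exactly k h. *)
Lemma barrier_normal_growth x (h : R) : x != 0 -> x 0 ord_max = 0 -> 0 <= h ->
  barrier dl k x + k * h <= barrier dl k (x + h *: basis_vec ord_max).
Proof.
move=> x0 xn h0.
have xh : enorm x <= enorm (x + h *: basis_vec ord_max).
  rewrite !enormE ler_wsqrtr// !(dotDl, dotDr, dotZl, dotZr) (dotC x (basis_vec _)).
  rewrite !dot_basis_vec xn !mxE !eqxx mulr0 !addr0 add0r mulr1 lerDl.
  by rewrite -expr2 sqr_ge0.
have lnxh : ln (enorm x) <= ln (enorm (x + h *: basis_vec ord_max)).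
  by rewrite ler_ln ?posrE// ?(lt_le_trans _ xh) ?enorm_gt0.
rewrite /barrier !mxE !eqxx mulr1 xn add0r mulr0 addr0 lerD2r.
by apply: lerD => //; rewrite lerD2l ler_pM2l.
Qed.

(** With D the increment of [v], maximality gives (w + k h) e^{-kD} <= w. Then e^s >= 1 + s yields h
    <= (w + k h) D. *)
Lemma normal_derivative_ge x : (flat_boundary `\` [set 0]) x ->
  0 < barrier dl k x <= 2 ->
  (\forall h \near (0 : R)^'+,
     barrier dl k (x + h *: basis_vec ord_max) *
       expR (- k * v (x + h *: basis_vec ord_max)) <=
     barrier dl k x * expR (- k * v x)) ->
  3^-1 <= normal_derivative v x.
Proof.
move=> fx /andP[w0 w2] maxP; apply: limr_ge.
  exact: normal_derivative_cvg v_C2 _ fx.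
have [[_ xn] /eqP x0] := fx.
have kV0 : 0 < k^-1 by rewrite invr_gt0.
near=> h.
have h0 : 0 < h by near: h; exact: nbhs_right_gt.
have hk : h <= k^-1 by near: h; exact: nbhs_right_le.
have le1 : barrier dl k (x + h *: basis_vec ord_max) *
       expR (- k * v (x + h *: basis_vec ord_max)) <=
     barrier dl k x * expR (- k * v x) by near: h; exact: maxP.
have := barrier_normal_growth x0 xn (ltW h0).
move: le1 w0 w2; set y := x + _; move: (barrier dl k x) (barrier dl k y) => w w'.
move=> le1 w0 w2 ww'.
set D := v y - v x.
have wh0 : 0 < w + k * h by rewrite addr_gt0// mulr_gt0.
have le2 : (w + k * h) * expR (- k * D) <= w.
  have Ex := expR_gt0 (- k * v x).
  have vE : - k * D + - k * v x = - k * v y by rewrite /D; ring.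
  rewrite -(ler_pM2r Ex) -mulrA -expRD vE.
  by apply: le_trans le1; rewrite ler_pM2r ?expR_gt0.
have le3 : (w + k * h) * (1 + - k * D) <= w.
  by apply: le_trans le2; rewrite ler_pM2l// expR_ge1Dx.
have le4 : h <= (w + k * h) * D by rewrite -(ler_pM2l k0); lra.
(* The constant 3 is the bound 2 on the barrier plus k h <= 1. *)
have wh3 : w + k * h <= 3.
  have : k * h <= 1 by rewrite -(mulfV (lt0r_neq0 k0)) ler_pM2l.
  lra.
have D0 : 0 <= D by rewrite -(pmulr_rge0 _ wh0) (le_trans (ltW h0)).
rewrite mulrC ler_pdivlMr//.
have : (w + k * h) * D <= 3 * D by exact: ler_wpM2r.
lra.
Unshelve. all: by end_near. Qed.

End boundary.

(** * Compactness and continuity for the weight *)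

Section compactness.
Variables (R : realType) (n : nat).
Implicit Types (x y : 'rV[R]_n.+1).

(** It includes its flat part; for [r1 = r2] it is a closed half sphere. *)
Definition half_annulus (r1 r2 : R) : set 'rV[R]_n.+1 :=
  [set x | r1 <= enorm x <= r2 /\ 0 <= x 0 ord_max].

Lemma compact_half_annulus r1 r2 : compact (half_annulus r1 r2).
Proof.
apply: bounded_closed_compact.
  exists r2; split; first exact: num_real.
  move=> M r2M x [/andP[_ xr2] _] /=.
  have M0 : 0 <= M by apply: le_trans (ltW r2M); exact: le_trans (enorm_ge0 x) xr2.
  rewrite [leLHS]/Num.norm/= mx_normrE; apply: bigmax_le => // -[i j] _ /=.
  rewrite ord1; apply: le_trans (le_coord_enorm x j) _.
  exact: le_trans xr2 (ltW r2M).
rewrite (_ : half_annulus r1 r2 =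
  (@enorm R n) @^-1` [set y | r1 <= y] `&` (@enorm R n) @^-1` [set y | y <= r2]
  `&` (fun x : 'rV[R]_n.+1 => x 0 ord_max) @^-1` [set y | 0 <= y]); last first.
  apply/seteqP; split => x /= [].
    by move=> /andP[].
  by move=> [r1x xr2] xn; split=> //; rewrite r1x.
by apply: closedI; [apply: closedI|]; apply: closed_comp;
  [move=> y _; exact: enorm_continuous|exact: closed_ge
  |move=> y _; exact: enorm_continuous|exact: closed_le
  |move=> y _; exact: coord_continuous|exact: closed_ge].
Qed.

Lemma half_annulus_punctured r1 r2 : 0 < r1 -> r2 < 1 ->
  half_annulus r1 r2 `<=` punctured_half_ball.
Proof.
move=> r10 r21 x [/andP[r1x xr2] xn]; split.
  by apply: half_ball_closure => //; exact: le_lt_trans r21.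
by move=> /= x0; move: (lt_le_trans r10 r1x); rewrite enorm_gt0 x0 eqxx.
Qed.

Lemma barrier_continuous dl k x : x != 0 -> {for x, continuous (@barrier R n dl k)}.
Proof.
rewrite -enorm_gt0 => x0.
rewrite (_ : barrier dl k = cst 1 + (cst dl * (@ln R \o @enorm R n)) +
  @enorm R n + (cst k * (fun x : 'rV[R]_n.+1 => x 0 ord_max)))//.
apply: continuousD; last first.
  by apply: continuousM; [exact: cst_continuous|exact: coord_continuous].
apply: continuousD; last exact: enorm_continuous.
apply: continuousD; first exact: cst_continuous.
apply: continuousM; first exact: cst_continuous.
by apply: continuous_comp; [exact: enorm_continuous|exact: continuous_ln].
Qed.

Lemma barrier_weight_continuous (v : 'rV[R]_n.+1 -> R) (A : set 'rV[R]_n.+1) dl k :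
  {within A, continuous v} -> ~ A 0 ->
  {within A, continuous (fun x => barrier dl k x * expR (- k * v x))}.
Proof.
move=> cv A0.
have cb : {within A, continuous (@barrier R n dl k)}.
  apply: continuous_in_subspaceT => x; rewrite inE => Ax.
  by apply: barrier_continuous; apply/eqP => x0; apply: A0; rewrite -x0.
move=> x; apply: continuousM; first exact: cb.
apply: (@continuous_comp _ _ _ (fun x : subspace A => - k * v x) expR).
  by apply: continuousM; [exact: cst_continuous|exact: cv].
exact: continuous_expR.
Qed.

End compactness.

(** * Lower bound for v by comparison *)

Section comparison.
Variables (R : realType) (n : nat) (c : R).
Variables (Gamma : set 'rV[R]_n.+1) (v : 'rV[R]_n.+1 -> R) (eta k K : R).
Hypotheses (v_C2 : C2_up_to_boundary half_ball punctured_half_ball v)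
  (v_int : forall x, half_ball x ->
       eigenvalues_in (conformal_hessian v x) (closure Gamma))
  (v_bd : forall x, (flat_boundary `\` [set 0]) x ->
       normal_derivative v x <= c * expR (v x))
  (eta01 : 0 < eta <= 1) (kE : k = eta / 32)
  (Gamma_eta : forall (lam : 'rV[R]_n.+1) t (q : 'S_n.+1), 0 < t ->
   (forall i, lam 0 (q i) <= (if i == ord0 then t * (1 + eta) else - t)) ->
   ~ closure Gamma lam)
  (K_c : 3 * `|c| <= K)
  (K_v : forall x, half_annulus 2^-1 2^-1 x -> - K <= v x).

Lemma barrier_le (x : 'rV[R]_n.+1) dl : 0 < dl -> 0 < k <= 1 ->
  0 < enorm x <= 2^-1 -> barrier dl k x <= 2 + dl * ln (enorm x).
Proof.
move=> dl0 /andP[k0 k1] /andP[x0 x2].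
have xn : k * x 0 ord_max <= 2^-1.
  have := le_trans (ler_norm _) (le_trans (le_coord_enorm x ord_max) x2).
  move=> xn; apply: le_trans (_ : k * 2^-1 <= _); first by rewrite ler_pM2l.
  by rewrite ler_piMl.
by rewrite /barrier; lra.
Qed.

(** The bound is uniform in [dl]. If it failed, the maximum point would satisfy v < - K, where [K]
    is chosen to exclude the outer sphere through [K_v] and the flat boundary through [K_c]. *)
Lemma barrier_weight_le dl x : 0 < dl -> punctured_half_ball x ->
  enorm x <= 2^-1 -> barrier dl k x * expR (- k * v x) <= expR (1 + k * K).
Proof.
move=> dl0 [xcl /eqP x0] x2.
have k01 : 0 < k <= 1.
  by rewrite kE divr_gt0//=; case/andP: eta01 => // ? ?; lra.
have [k0 k1] := andP k01.
(* Below this radius dl ln |x| <= - 3, which outweighs the bound 2 on the rest of the barrier. *)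
pose r1 := expR (- 3 / dl).
have r10 : 0 < r1 by exact: expR_gt0.
have small (y : 'rV[R]_n.+1) : 0 < enorm y -> enorm y <= r1 -> enorm y <= 2^-1 ->
    barrier dl k y <= 0.
  move=> y0 yr1 y2; have := barrier_le dl0 k01 (introT andP (conj y0 y2)).
  have : dl * ln (enorm y) <= - 3.
    rewrite -ler_pdivlMl// mulrC; rewrite -(@expRK R (- 3 / dl)).
    by rewrite ler_ln ?posrE.
  lra.
have [xr1|r1x] := leP (enorm x) r1.
  rewrite (le_trans _ (expR_ge0 _))// mulr_le0_ge0 ?expR_ge0//.
  by apply: small => //; rewrite enorm_gt0.
rewrite leNgt; apply/negP => ltx.
pose A : set 'rV[R]_n.+1 := half_annulus r1 2^-1.
have half1 : 2^-1 < 1 :> R by rewrite invf_lt1// ltr1n.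
have Ax : A x by split; [rewrite (ltW r1x)|exact: closure_half_ball].
have AE : A `<=` punctured_half_ball by exact: half_annulus_punctured.
have cG : {within A, continuous (fun x => barrier dl k x * expR (- k * v x))}.
  case: v_C2 => cv _ _ _ _.
  have cvA : {within A, continuous v} by exact: continuous_subspaceW AE cv.
  apply: (@barrier_weight_continuous _ _ v A) => //.
  by move=> /AE[_]; exact.
have [y] := EVT_max_rV (ex_intro _ x Ax) (@compact_half_annulus R n r1 2^-1) cG.
rewrite inE => Ay maxy.
have {ltx} lty := lt_le_trans ltx (maxy x (mem_set Ax)).
have [/andP[r1y y2] yn] := Ay.
have y0 : 0 < enorm y by exact: lt_le_trans r1y.
have w0 : 0 < barrier dl k y.
  by rewrite -(pmulr_lgt0 _ (expR_gt0 (- k * v y))) (lt_trans (expR_gt0 _) lty).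
have {}r1y : r1 < enorm y.
  rewrite lt_neqAle r1y andbT; apply: contraTneq w0 => r1E.
  by rewrite -leNgt small// -r1E.
have w2 : barrier dl k y <= 2.
  apply: le_trans (barrier_le dl0 k01 (introT andP (conj y0 y2))) _.
  by rewrite gerDl mulr_ge0_le0 ?(ltW dl0)// ln_le0// (le_trans y2)// ltW.
(* The extra 1 in the exponent pays for w <= 2, as 2 <= e. *)
have vy : v y < - K.
  have : 2 * expR (k * K) < 2 * expR (- k * v y).
    apply: lt_le_trans (_ : barrier dl k y * expR (- k * v y) <= _); last first.
      by rewrite ler_pM2r ?expR_gt0.
    apply: le_lt_trans lty; rewrite expRD ler_pM2r ?expR_gt0//.
    exact: expR_ge1Dx.
  by rewrite ltr_pM2l// ltr_expR mulNr -mulrN ltr_pM2l// ltrNr.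
have {}y2 : enorm y < 2^-1.
  rewrite lt_neqAle y2 andbT; apply: contraTneq vy => y2E.
  by rewrite -leNgt; apply: K_v; split=> //; rewrite y2E lexx.
(* Both radial inequalities are now strict at [y], so its maximality on [A] is local within the
   closed half space. *)
have yA : \forall z \near y, 0 <= (z : 'rV[R]_n.+1) 0 ord_max -> A z.
  have yl : \forall z \near y, r1 < enorm z :=
    @enorm_continuous R n y _ (lt_nbhsr r1y).
  have yr : \forall z \near y, enorm z < 2^-1 :=
    @enorm_continuous R n y _ (lt_nbhsl y2).
  by apply: filterS2 yl yr => z /ltW rz /ltW zr zn; split=> //; rewrite rz.
move: yn; rewrite le_eqVlt => /predU1P[yn|yn]; last first.
  have hy : half_ball y by split => //; exact: lt_trans half1.
  apply: (no_interior_touching v_C2 eta01 kE dl0 Gamma_eta hy w0 _ (v_int hy)).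
  apply: filterS2 yA (near_half_ball hy) => z zA [_ /ltW/zA Az].
  exact: maxy (mem_set Az).
have fy : (flat_boundary `\` [set 0]) y.
  split; first by split=> //; exact: lt_trans half1.
  by apply/eqP; rewrite -enorm_gt0.
have : 3^-1 <= normal_derivative v y.
  apply: (normal_derivative_ge v_C2 k0 dl0 fy); first by rewrite w0.
  have lc : y + h *: basis_vec ord_max @[h --> (0 : R)] --> y.
    have := @line_continuous R n y (basis_vec ord_max) 0.
    by rewrite /continuous_at scale0r addr0.
  have lA : \forall h \near (0 : R)^'+,
      0 <= (y + h *: basis_vec ord_max) 0 ord_max ->
      A (y + h *: basis_vec ord_max).
    exact: (cvg_at_right_filter lc) _ yA.
  apply: filterS2 lA (nbhs_right_gt 0) => h hA h0.
  apply: (maxy _ (mem_set (hA _))).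
  by rewrite !mxE !eqxx mulr1 -yn add0r ltW.
move=> /le_trans/(_ (v_bd fy)); apply/negP; rewrite -ltNge.
have K0 : 0 <= K by apply: le_trans K_c; rewrite mulr_ge0.
(* Then |c| e^v <= |c| / (1 + K) < 1 / 3, because 3 |c| <= K. *)
have vE : expR (v y) < (1 + K)^-1.
  apply: lt_le_trans (_ : expR (- K) <= _); first by rewrite ltr_expR.
  by rewrite expRN lef_pV2 ?posrE ?expR_gt0 ?expR_ge1Dx// ltr_pwDl.
apply: le_lt_trans (_ : `|c| * expR (v y) < _).
  by rewrite ler_wpM2r ?expR_ge0// ler_norm.
apply: le_lt_trans (_ : `|c| * (1 + K)^-1 < _).
  by rewrite ler_wpM2l// ltW.
have K10 : 0 < 1 + K by rewrite ltr_pwDl.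
by rewrite ltr_pdivrMr// mulrC ltr_pdivlMr// mulrC (le_lt_trans K_c)// ltrDr.
Qed.

(** As the weight is bounded uniformly in [dl], a value of [dl] adapted to [x] replaces the limit dl
    -> 0. *)
Lemma lower_bound x : punctured_half_ball x -> enorm x <= 2^-1 ->
  - (K + k^-1) <= v x.
Proof.
move=> Ex x2.
have k0 : 0 < k by rewrite kE divr_gt0//; case/andP: eta01.
have r0 : 0 < enorm x by rewrite enorm_gt0; apply/eqP; case: Ex.
(* This gives dl ln |x| >= - |x|, so the term |x| of the barrier compensates the logarithm and w >=
   1. *)
pose dl := enorm x / (1 + `|ln (enorm x)|).
have dl0 : 0 < dl by rewrite divr_gt0// ltr_pwDl.
have w1 : 1 <= barrier dl k x.
  have xn : 0 <= k * x 0 ord_max.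
    by rewrite mulr_ge0 ?(ltW k0)//; case: Ex => /closure_half_ball.
  have : - enorm x <= dl * ln (enorm x).
    rewrite lerNl -mulrN; apply: le_trans (_ : dl * `|ln (enorm x)| <= _).
      by rewrite ler_pM2l// -normrN ler_norm.
    rewrite /dl -mulrA ler_piMr ?(ltW r0)// mulrC ler_pdivrMr ?ltr_pwDl//.
    by rewrite mul1r lerDr.
  by rewrite /barrier; lra.
have := barrier_weight_le dl0 Ex x2.
have : expR (- k * v x) <= barrier dl k x * expR (- k * v x).
  by rewrite ler_peMl ?expR_ge0.
move=> /le_trans h /h; rewrite ler_expR => h2.
rewrite -(ler_pM2l k0) mulrN mulrDr mulfV ?gt_eqF//; lra.
Qed.

End comparison.
Theorem proposition2p1 (R : realType) (n : nat) (hn : (2 <= n.+1)%N) (c : R)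
    (Gamma : set 'rV[R]_n.+1)
    (Gamma_proper : Gamma `<` setT)
    (Gamma_neq0 : Gamma !=set0)
    (Gamma_open : open Gamma)
    (Gamma_sym : symmetric_set Gamma)
    (Gamma_cone : cone_at_origin Gamma)
    (Gamma_add : [set lam + mu | lam in Gamma & mu in positive_orthant]
                   `<=` Gamma)
    (Gamma_star : ~ closure Gamma lambda_star)
    (v : 'rV[R]_n.+1 -> R)
    (v_C2 : C2_up_to_boundary half_ball punctured_half_ball v)
    (v_int : forall x, half_ball x ->
       eigenvalues_in (conformal_hessian v x) (closure Gamma))
    (v_bd : forall x, (flat_boundary `\` [set 0]) x ->
       normal_derivative v x <= c * expR (v x)) :
  (-oo < limf_einf (fun x => (v x)%:E)
           (within punctured_half_ball (nbhs (0%R : 'rV[R]_n.+1))))%E.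
Proof.
have [eta eta01 Gamma_eta] :=
  closure_avoids_near_lambda_star Gamma_sym Gamma_cone Gamma_add Gamma_star.
have [m mP] : exists m, forall x, half_annulus 2^-1 2^-1 x -> m <= v x.
  have [S0|S0] := pselect (@half_annulus R n 2^-1 2^-1 !=set0); last first.
    by exists 0 => x Sx; exfalso; apply: S0; exists x.
  have cv : {within half_annulus 2^-1 2^-1, continuous v}.
    case: v_C2 => cv _ _ _ _; apply: continuous_subspaceW cv.
    by apply: half_annulus_punctured; rewrite ?invr_gt0// invf_lt1// ltr1n.
  have [y _ yP] := EVT_min_rV S0 (@compact_half_annulus R n _ _) cv.
  by exists (v y) => x Sx; apply: yP; rewrite inE.
(* One summand for the flat boundary, one for the half sphere of radius 1 / 2. *)
pose K := 3 * `|c| + `|m|.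
have K_c : 3 * `|c| <= K by rewrite lerDl.
have K_v x : half_annulus 2^-1 2^-1 x -> - K <= v x.
  move=> /mP; apply: le_trans; rewrite lerNl.
  by rewrite (le_trans (ler_norm _))// normrN lerDr mulr_ge0.
have vK := lower_bound v_C2 v_int v_bd eta01 erefl Gamma_eta K_c K_v.
rewrite limf_einfE; apply: lt_le_trans (ltNyr (- (K + (eta / 32)^-1))) _.
apply: ereal_sup_ge.
(* The lower limit is a supremum of infima over neighborhoods; the part of the punctured half ball
   with |x| <= 1 / 2 is one of them. *)
exists (ereal_inf ((fun x => (v x)%:E) @`
  [set x | punctured_half_ball x /\ enorm x <= 2^-1])).
  exists [set x | punctured_half_ball x /\ enorm x <= 2^-1] => //.
  have l0 : \forall x \near (0 : 'rV[R]_n.+1), enorm x < 2^-1.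
    have e0 : enorm (0 : 'rV[R]_n.+1) < 2^-1.
      by rewrite (le_lt_trans _ (_ : 0 < _)) ?invr_gt0// leNgt enorm_gt0 eqxx.
    exact: (@enorm_continuous R n 0) _ (lt_nbhsl e0).
  by apply: filterS l0 => x /ltW x2 Ex; split.
by apply: le_ereal_inf_tmp => _ [x [Ex x2] <-]; rewrite lee_fin; exact: vK.
Qed.
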